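(* Let $W\in\mathbb{C}[z_1,\dots,z_n]$ be a non-degenerate weighted homogeneous polynomial with maximal diagonal symmetry group $G_W$. Let $g\in G_W$ and $l>0$, and let $\Sigma_{g,l}$ be the space of $g$-twisted Reeb orbits of period $l$ in the link of $W$, and $I=I_{g,l}$. The Robbin–Salamon index of the linearized Reeb flow in $\Sigma_{g,l}$ is $$\mu_{\mathrm{RS}}(\Sigma_{g,l})=2\Big(-\sum_{i\in I}\theta_{g,i}+\sum_{j\in I^c}(l\theta_{J,j}-l)\Big)+\sum_{i\in I}Q(l\theta_{J,i}+\theta_{g,i})+(|I^c|-1)Q(l),$$ where $Q(s)=2s$ if $s\in\mathbb{Z}$ and $Q(s)=2\lfloor s\rfloor+1$ if $s\notin\mathbb{Z}$.
   Context: $W$ has weight $(w_1,\dots,w_n;h)$: $W(\lambda^{w_1}z_1,\dots,\lambda^{w_n}z_n)=\lambda^hW(z)$, $\gcd(w_1,\dots,w_n,h)=1$; non-degenerate means isolated singularity at $0$ and no monomial $x_ix_j$, $i\ne j$. $G_W$ is the finite group of diagonal symmetries of $W$. For $g\in G_W$ write $g=(e^{2\pi i\theta_{g,1}},\dots,e^{2\pi i\theta_{g,n}})$ with $\theta_{g,i}\in[0,1)$; $J=(e^{2\pi iw_k/h})_k$ and $\theta_{J,k}=w_k/h$. The Reeb flow on the link $L_W=W^{-1}(0)\cap S^{2n-1}_\delta$ is $\mathcal{R}_t(z)=(e^{2\pi i\theta_{J,k}t}z_k)_k$. A $g$-twisted orbit of period $l$ is a flow line $\gamma:[0,l]\to L_W$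 with $g\cdot\gamma(l)=\gamma(0)$. $(\mathbb{C}^n)^{g,l}=\{z: z_i\ne0\Rightarrow\theta_{g,i}+l\theta_{J,i}\in\mathbb{Z}\}$ is the fixed locus of $g\circ\mathcal{R}_l$, and $\Sigma_{g,l}=(\mathbb{C}^n)^{g,l}\cap L_W$ (assumed non-empty, so that the index is defined). $I_{g,l}=\{i:\partial_iW|_{(\mathbb{C}^n)^{g,l}}\equiv0\}\subset\{1,\dots,n\}$, and $I^c$ is its complement. The link is identified with the contact boundary of the Milnor fiber $M_W$, with $TM_W|_\gamma=\ker dW|_\gamma$. The holomorphic volume form on fibers of $W$ is $\Omega_{M_W}=\mathrm{Res}_W\,dz_1\wedge\dots\wedge dz_n$; $\Omega_{M_W}^{\otimes|G_W|}$ descends to $[M_W/G_W]$, and $\mu_{RS}$ is the corresponding index divided by $|G_W|$. Concretely: for a complex frame $(f_i)$ of $\ker dW$ along $\gamma$ with $g\cdot f_i(l)=f_i(0)$, $\mu_{RS}$ is the Robbin–Salamon index of the linearized Reeb flow in this frame plus $2$ times the total change of $\frac1{2\pi}\arg\Omega_{M_W}(f_1,\dots,f_{n-1})$ over $[0,l]$. *)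

(* Defs.v *)
From HB Require Import structures.
From mathcomp Require Import all_boot all_order all_algebra.
From mathcomp Require Import all_classical all_reals all_analysis.
From mathcomp.real_closed Require Import complex.
(* Not imported: the notations of mpoly clash with those of mathcomp-analysis. *)
From mathcomp.multinomials Require mpoly.

Set Implicit Arguments.
Unset Strict Implicit.
Unset Printing Implicit Defensive.

Import Order.TTheory GRing.Theory Num.Theory.
Import numFieldNormedType.Exports.

Local Open Scope classical_set_scope.
Local Open Scope complex_scope.
Local Open Scope ring_scope.

(** * The Robbin-Salamon index of a path of symplectic matrices *)

Section Signature.
Variables (R : realType) (N : nat).
Implicit Types (K : set 'cV[R]_N) (q : 'cV[R]_N -> R).

(* Largest dimension of a subspace of K on which q is positive definite; the
   subspace is given as the image of B, which is necessarily injective. *)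
Definition pos_index K q : nat :=
  \max_(k < N.+1 | `[< exists B : 'M[R]_(N, k), forall c : 'cV[R]_k, c != 0 ->
                         K (B *m c) /\ 0 < q (B *m c) >]) k.

Definition signature K q : R :=
  (pos_index K q)%:R - (pos_index K (fun v => - q v))%:R.

End Signature.

Section RobbinSalamon.
Variables (R : realType) (m : nat).
Implicit Types (Psi Phi : R -> 'M[R]_(m + m)) (l t : R).

(* Multiplication by i on C^m = R^m + i R^m. *)
Definition J0 : 'M[R]_(m + m) := block_mx 0 (- 1%:M) 1%:M 0.

Definition symplectic (A : 'M[R]_(m + m)) : Prop := A^T *m J0 *m A = J0.

Definition omega0 (v w : 'cV[R]_(m + m)) : R := ((J0 *m v)^T *m w) 0 0.

Definition path_derivative Psi t : 'M[R]_(m + m) :=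
  \matrix_(i, j) derive1 (fun s => Psi s i j) t.

(* A C^1 path on [0, l] extends to a C^1 path of matrices on R, so one-sided
   derivatives at the endpoints are not needed. *)
Definition C1_path Psi : Prop :=
  forall i j, (forall t, derivable (fun s => Psi s i j) t 1) /\
              continuous (derive1 (fun s => Psi s i j)).

Definition crossing_space Psi t : set 'cV[R]_(m + m) :=
  [set v | Psi t *m v = v].

(* The crossing form is (v, w) |-> omega0 v (Psi'(t) w) on ker (1 - Psi t).  If
   Psi' = J0 S Psi, it is the restriction of the symmetric matrix S. *)
Definition crossing_form Psi t (v : 'cV[R]_(m + m)) : R :=
  omega0 v (path_derivative Psi t *m v).

Definition regular_crossing Psi t : Prop :=
  forall v, crossing_space Psi t v ->
    (forall w, crossing_space Psi t w -> omega0 w (path_derivative Psi t *m v) = 0) ->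
    v = 0.

Definition crossing_signature Psi t : R :=
  signature (crossing_space Psi t) (crossing_form Psi t).

(* Only crossings contribute, and they are isolated when all are regular, so
   that the sum over ]0, l[ is finite. *)
Definition crossing_number l Psi : R :=
  2^-1 * crossing_signature Psi 0
  + \sum_(t \in [set` `]0, l[]) crossing_signature Psi t
  + 2^-1 * crossing_signature Psi l.

Definition symplectic_homotopic l Psi Phi : Prop :=
  exists H : R * R -> 'M[R]_(m + m),
  [/\ forall i j,
        {within `[0, 1] `*` `[0, l], continuous (fun p => H p i j)},
      forall s t, 0 <= s <= 1 -> 0 <= t <= l -> symplectic (H (s, t)),
      forall t, 0 <= t <= l -> H (0, t) = Psi t /\ H (1, t) = Phi t
    & forall s, 0 <= s <= 1 -> H (s, 0) = Psi 0 /\ H (s, l) = Psi l].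

(* RS_index l Psi r : the path Psi : [0, l] -> Sp(2m) has index r, i.e. it is
   homotopic with fixed endpoints to a C^1 path with only regular crossings whose
   crossing number is r.  Such a path always exists and r does not depend on it
   (Robbin-Salamon).  Normalization: e^(it) turns with positive index. *)
Definition RS_index l Psi (r : R) : Prop :=
  exists Phi : R -> 'M[R]_(m + m),
  [/\ symplectic_homotopic l Psi Phi,
      C1_path Phi,
      forall t, 0 <= t <= l -> regular_crossing Phi t
    & crossing_number l Phi = r].

End RobbinSalamon.

(** * Complex-valued paths *)

Section Complex.
Variable R : realType.

(* e^(2 pi i t) *)
Definition expi (t : R) : R[i] := cos (2 * pi * t) +i* sin (2 * pi * t).

Definition realify (m : nat) (A : 'M[R[i]]_m) : 'M[R]_(m + m) :=
  let X := map_mx (@complex.Re R) A in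
  let Y := map_mx (@complex.Im R) A in
  block_mx X (- Y) Y X.

Definition adjoint (p q : nat) (A : 'M[R[i]]_(p, q)) : 'M[R[i]]_(q, p) :=
  (map_mx Num.conj A)^T.

Definition mx_continuous (p q : nat) (l : R) (F : R -> 'M[R[i]]_(p, q)) : Prop :=
  forall i j,
    {within `[0, l], continuous (fun t => complex.Re (F t i j))} /\
    {within `[0, l], continuous (fun t => complex.Im (F t i j))}.

(* phi is a continuous branch of (1 / 2 pi) arg u on [0, l] *)
Definition arg_branch (l : R) (u : R -> R[i]) (phi : R -> R) : Prop :=
  {within `[0, l], continuous phi} /\
  forall t, 0 <= t <= l -> exists r : R, 0 < r /\ u t = r%:C * expi (phi t).

End Complex.

(** * Weighted homogeneous polynomials and their symmetries *)

Section Polynomial.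
Variables (R : realType) (n : nat) (W : mpoly.mpoly n R[i]).
Implicit Types (z g : 'cV[R[i]]_n).

Definition weval z : R[i] := mpoly.meval (fun i => z i 0) W.

Definition wpartial (i : 'I_n) z : R[i] :=
  mpoly.meval (fun k => z k 0) (mpoly.mderiv i W).

Definition dW z : 'rV[R[i]]_n := \row_i wpartial i z.

Definition sqnorm z : R := \sum_i (complex.Re (z i 0) ^+ 2 + complex.Im (z i 0) ^+ 2).

Definition has_weight (w : 'I_n -> nat) (h : nat) : Prop :=
  [/\ forall i, (0 < w i)%N,
      (0 < h)%N,
      gcdn (\big[gcdn/0%N]_i w i) h = 1%N
    & forall (c : R[i]) z,
        weval (\col_i (c ^+ w i * z i 0)) = c ^+ h * weval z].

Definition isolated_singularity : Prop :=
  weval 0 = 0 /\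
  exists eps : R, 0 < eps /\
    forall z, sqnorm z < eps ^+ 2 -> (dW z = 0 <-> z = 0).

Definition nondegenerate_poly : Prop :=
  isolated_singularity /\
  forall i j : 'I_n, i != j ->
    mpoly.mcoeff (mpoly.mnm_add (mpoly.mnm1 i) (mpoly.mnm1 j)) W = 0.

Definition cdiag (d : 'cV[R[i]]_n) : 'M[R[i]]_n := diag_mx d^T.

(* the maximal group of diagonal symmetries *)
Definition G_W : set 'cV[R[i]]_n :=
  [set g : 'cV[R[i]]_n | (forall i, g i 0 != 0) /\ forall z, weval (cdiag g *m z) = weval z].

End Polynomial.

(** * Twisted Reeb orbits and their index *)

Section Index.
Variables (R : realType) (m : nat).
(* n = m.+1, so that ker dW has rank m along an orbit. *)
Local Notation n := m.+1.
Variables (W : mpoly.mpoly n R[i]) (w : 'I_n -> nat) (h : nat).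
Variables (g : 'cV[R[i]]_n) (theta : 'I_n -> R) (delta l : R).
Implicit Types (z : 'cV[R[i]]_n) (F : R -> 'M[R[i]]_(n, m)).

Definition link : set 'cV[R[i]]_n :=
  [set z : 'cV[R[i]]_n | weval W z = 0 /\ sqnorm z = delta ^+ 2].

Definition theta_J (k : 'I_n) : R := (w k)%:R / h%:R.

(* The Reeb flow is linear in z, hence equal to its own linearization. *)
Definition reeb (t : R) : 'M[R[i]]_n := cdiag (\col_k expi (theta_J k * t)).

Definition fixed_locus : set 'cV[R[i]]_n :=
  [set z : 'cV[R[i]]_n | forall i, z i 0 != 0 -> theta i + l * theta_J i \is a Num.int].

(* The orbit t |-> reeb t *m z is identified with its starting point z. *)
Definition Sigma : set 'cV[R[i]]_n := fixed_locus `&` link.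

Definition I_gl : {set 'I_n} :=
  [set i | `[< forall z, fixed_locus z -> wpartial W i z = 0 >]].

(* A g-equivariant complex frame of ker dW along the orbit of z, given by the
   columns of F t.  It is unitary, i.e. also symplectic for the restriction of the
   standard form to ker dW, so that the flow in this frame is a path in Sp(2m). *)
Definition is_frame z F : Prop :=
  [/\ mx_continuous l F,
      forall t, 0 <= t <= l -> dW W (reeb t *m z) *m F t = 0,
      forall t, 0 <= t <= l -> adjoint (F t) *m F t = 1%:M
    & cdiag g *m F l = F 0].

(* Since F t is unitary, this is the matrix of the linearized flow
   ker dW_z -> ker dW_(reeb t *m z) in the frame. *)
Definition flow_in_frame F (t : R) : 'M[R[i]]_m :=
  adjoint (F t) *m (reeb t *m F 0).

(* c = Res_W (dz_1 ... dz_n) (f_1, ..., f_m) at the point z, where the f_j in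
   ker dW_z are the columns of B: dz_1 ... dz_n = dW /\ Res. *)
Definition is_residue z (B : 'M[R[i]]_(n, m)) (c : R[i]) : Prop :=
  forall v : 'cV[R[i]]_n, (dW W z *m v) 0 0 * c = \det (row_mx v B : 'M[R[i]]_(1 + m)).

Definition index_in_frame z F (r : R) : Prop :=
  exists (Om : R -> R[i]) (phi : R -> R) (s : R),
  [/\ forall t, 0 <= t <= l -> is_residue (reeb t *m z) (F t) (Om t),
      arg_branch l Om phi,
      RS_index l (fun t => realify (flow_in_frame F t)) s
    & r = s + 2 * (phi l - phi 0)].

(* The index is computed in any frame along any orbit in the family. *)
Definition mu_RS (r : R) : Prop :=
  Sigma !=set0 /\
  forall z, Sigma z ->
    (exists F, is_frame z F) /\
    (forall F, is_frame z F -> index_in_frame z F r).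

End Index.

Arguments theta_J {R m} w h k.

Definition Q (R : realType) (s : R) : R :=
  if s \is a Num.int then 2 * s else 2 * (Num.floor s)%:~R + 1.

(* Main.v *)
(** Along an orbit, C^n splits as ker dW plus the line spanned by the normal
    vector dW^*, and the Reeb flow R_t respects the splitting: it turns the normal
    line with speed 1. In a unitary frame F the linearized flow on ker dW is thus
    a path A of unitary matrices from 1, and comparing determinants shows that its
    winding is the sum of the theta_J, minus 1, minus the winding of the volume
    form in F. The endpoint A(l) is conjugate to the restriction of g R_l to
    ker dW, whose eigenvalues are exp (2 pi i (l theta_J + theta)) for the indices
    in I, and exp (2 pi i l) with multiplicity |I^c| - 1 because g R_l multiplies
    dW by exp (2 pi i l). A path of unitary matrices is determined up to homotopy
    by its endpoints and the winding of its determinant, so A is homotopic to a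
    diagonal path P diag (exp (2 pi i f_j)) P^*, whose index is the sum of the
    Q (f_j (l)). Finally Q (s + k) = Q s + 2 k for an integer k, so only the total
    winding matters, and the contributions of the frame cancel. *)

Require Import Defs.
From mathcomp Require Import all_boot all_order all_algebra.
From mathcomp Require Import all_classical all_reals all_analysis.
From mathcomp.real_closed Require Import complex.
From mathcomp.multinomials Require mpoly.
From mathcomp Require Import ring lra.
Import Order.TTheory GRing.Theory Num.Theory.
Import numFieldNormedType.Exports.
Set Implicit Arguments.
Unset Strict Implicit.
Unset Printing Implicit Defensive.
Local Open Scope classical_set_scope.
Local Open Scope complex_scope.
Local Open Scope ring_scope.

(** The homotopy statement says that the determinant detects the fundamental group of the unitary
    group. Instead of a fibration argument, the first column of a loop is moved to a constant vector
    by explicit unitary matrices, which depend continuously on their data and are the identity when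
    nothing has to move. A continuous loop may fill the whole sphere and leave no direction to push
    it to, hence the detour through a polygon. Induction on the size then leaves a loop in the last
    diagonal entry, which the determinant controls. The integer that separates the total winding
    from the chosen phases of the endpoint must be charged to one of the [m] phases. For [m = 0]
    there is none, and the integer has to vanish: the winding is then a continuous integer-valued
    function that starts at 0. The eigenvectors of [g R_l] serve twice: they give an equivariant
    frame, whose existence is part of [mu_RS], and they diagonalize the return map in every other
    frame. *)

Section Expi.
Variable R : realType.
Implicit Types (x y t : R) (z : R[i]).

Lemma expi0 : expi (0 : R) = 1.
Proof. by rewrite /expi mulr0 cos0 sin0. Qed.

Lemma expiD x y : expi (x + y) = expi x * expi y.
Proof.
rewrite /expi mulrDr cosD sinD; apply/eqP; rewrite eq_complex /=.
by apply/andP; split => //; apply/eqP; ring.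
Qed.

Lemma conj_expi x : Num.conj (expi x) = expi (- x).
Proof. by rewrite /expi mulrN cosN sinN. Qed.

Lemma expiM_N x : expi x * expi (- x) = 1.
Proof. by rewrite -expiD subrr expi0. Qed.

Lemma expi_neq0 x : expi x != 0.
Proof.
by apply/eqP => e0; have /eqP := expiM_N x; rewrite e0 mul0r eq_sym oner_eq0.
Qed.

Lemma expiV x : (expi x)^-1 = expi (- x).
Proof. by apply: (mulfI (expi_neq0 x)); rewrite mulfV ?expi_neq0 // expiM_N. Qed.

Lemma expiX x n : expi x ^+ n = expi (x * n%:R).
Proof.
elim: n => [|n IHn]; first by rewrite mulr0 expi0.
by rewrite exprS IHn -expiD -natr1 mulrDr mulr1 addrC.
Qed.

Lemma expi_sum (I : Type) (r : seq I) (P : pred I) (F : I -> R) :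
  expi (\sum_(i <- r | P i) F i) = \prod_(i <- r | P i) expi (F i).
Proof.
by elim/big_rec2: _ => [|i y z _ IH]; rewrite ?expi0 // expiD IH.
Qed.

Lemma expi_half : expi (2^-1 : R) = -1.
Proof.
rewrite /expi mulrAC mulfV ?pnatr_eq0 // mul1r cospi sinpi.
by apply/eqP; rewrite eq_complex /= oppr0 !eqxx.
Qed.

Lemma expi1 : expi (1 : R) = 1.
Proof.
have -> : (1 : R) = 2^-1 + 2^-1 by lra.
by rewrite expiD expi_half mulrNN mulr1.
Qed.

Lemma expi_int x : x \is a Num.int -> expi x = 1.
Proof.
have expin n : expi (n%:R : R) = 1 by rewrite -[n%:R]mul1r -expiX expi1 expr1n.
move=> /intrP[[n|n] ->]; first by rewrite expin.
by rewrite NegzE rmorphN /= -conj_expi expin rmorph1.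
Qed.

(** For the fractional part [y], the half-angle formula turns [cos (2 * pi * y) = 1] into
    [sin (pi * y) = 0], while the sine is positive on ]0, pi[. *)
Lemma expi_eq1 x : (expi x == 1) = (x \is a Num.int).
Proof.
apply/idP/idP => [/eqP e1|/expi_int -> //].
have xE : x = (Num.floor x)%:~R + (x - (Num.floor x)%:~R) by rewrite addrC subrK.
set y := x - _ in xE.
have y01 : 0 <= y < 1.
  by rewrite subr_ge0 Num.Theory.floor_le /= ltrBlDl -intrD1 Num.Theory.floorD1_gt.
have : expi y = 1.
  by move: e1; rewrite {1}xE expiD expi_int ?mul1r ?intr_int.
rewrite /expi => -[c1 _].
have s0 : sin (pi * y) = 0.
  apply/eqP; rewrite -sqrf_eq0 sin2cos2; apply/eqP.
  have : 2 * pi * y = (pi * y) *+ 2 by rewrite mulr2n; ring.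
  by move=> E; move: c1; rewrite E cos_mulr2n; lra.
have [y0|y0] := ltP 0 y.
  have : 0 < sin (pi * y).
    by apply: sin_gt0_pi; rewrite mulr_gt0 ?pi_gt0 //= gtr_pMr ?pi_gt0 //; lra.
  by rewrite s0 ltxx.
have {}y0 : y = 0 by lra.
by rewrite xE y0 addr0 intr_int.
Qed.

Lemma expi_eq x y : (expi x == expi y) = (x - y \is a Num.int).
Proof.
rewrite -expi_eq1 expiD -expiV -(inj_eq (mulIf (invr_neq0 (expi_neq0 y)))).
by rewrite mulfV ?expi_neq0.
Qed.

Lemma polarD x y : 0 < x ->
  exists2 r, 0 < r & x +i* y = r%:C * expi (atan (y / x) / (2 * pi)).
Proof.
move=> x0; set a := atan _.
have [ab ta] := atan_def (y / x); rewrite -/a in ab ta.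
have ca : 0 < cos a by apply: cos_gt0_pihalf.
have aE : 2 * pi * (a / (2 * pi)) = a.
  by rewrite mulrC divfK // mulf_neq0 ?pnatr_eq0 ?gt_eqF ?pi_gt0.
have ca0 : cos a != 0 by rewrite gt_eqF.
exists (x / cos a); first by rewrite divr_gt0.
have y_ : y = x * (sin a / cos a).
  by rewrite -[sin a / cos a]/(tan a) ta mulrC divfK ?gt_eqF.
rewrite /expi aE; apply/eqP; rewrite eq_complex /= !mul0r subr0 addr0.
by rewrite y_ divfK // eqxx /= mulrA mulrAC.
Qed.

(** The arctangent handles the right half-plane; a half turn reaches the left one, and a quarter
    turn reduces the imaginary axis to these. *)
Lemma polar z : z != 0 -> exists r x : R, 0 < r /\ z = r%:C * expi x.
Proof.
have pos (u : R[i]) : 0 < complex.Re u -> exists r x : R, 0 < r /\ u = r%:C * expi x.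
  by case: u => a b /= /(polarD b)[r r0 ->]; exists r, (atan (b / a) / (2 * pi)).
have neg (u : R[i]) : complex.Re u != 0 -> exists r x : R, 0 < r /\ u = r%:C * expi x.
  rewrite neq_lt => /orP[u0|/pos//].
  have [|r [x [r0 E]]] := pos (- u); first by rewrite raddfN /= oppr_gt0.
  exists r, (x + 2^-1); split=> //.
  by rewrite expiD expi_half mulrA -E mulrN1 opprK.
have [Re0|/neg//] := eqVneq (complex.Re z) 0.
move=> z0.
have [|r [x [r0 E]]] := neg (z * 'i).
  rewrite ReiNIm oppr_eq0; apply: contra z0 => /eqP Im0.
  by rewrite eq_complex Re0 Im0 !eqxx.
exists r, (x - 4^-1); split=> //.
have i4 : expi (4^-1 : R) = 'i.
  rewrite /expi; have -> : 2 * pi * 4^-1 = pi / 2 :> R by field.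
  by rewrite cos_pihalf sin_pihalf.
rewrite expiD mulrA -E -expiV i4 -mulrA mulfV ?mulr1 //.
by apply/eqP => -[]/eqP; rewrite oner_eq0.
Qed.

End Expi.

(** * Continuous paths of complex matrices *)

Section Continuity.
Variable R : realType.

(* R[i] carries no topology, so its continuity is that of both components. *)
Definition ccont (T : topologicalType) (f : T -> R[i]) (x : T) : Prop :=
  {for x, continuous (fun y => complex.Re (f y))} /\
  {for x, continuous (fun y => complex.Im (f y))}.

Lemma cont_ext (T : topologicalType) (f g : T -> R) (x : T) :
  f =1 g -> {for x, continuous g} -> {for x, continuous f}.
Proof. by move=> /funext ->. Qed.

Section Scalar.
Variables (T : topologicalType) (x : T).
Implicit Types (f g : T -> R[i]) (a : T -> R).

Lemma ccont_cst (c : R[i]) : ccont (fun _ => c) x.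
Proof. by split; exact: cst_continuous. Qed.

Lemma ccont_real a : {for x, continuous a} -> ccont (fun y => (a y)%:C) x.
Proof. by move=> ca; split => //=; exact: cst_continuous. Qed.

Lemma ccontD f g : ccont f x -> ccont g x -> ccont (fun y => f y + g y) x.
Proof.
move=> [f1 f2] [g1 g2]; split.
  by apply: (cont_ext (fun y => raddfD _ _ _)); exact: continuousD.
by apply: (cont_ext (fun y => raddfD _ _ _)); exact: continuousD.
Qed.

Lemma ccontN f : ccont f x -> ccont (fun y => - f y) x.
Proof.
move=> [f1 f2]; split.
  by apply: (cont_ext (fun y => raddfN _ _)); exact: continuousN.
by apply: (cont_ext (fun y => raddfN _ _)); exact: continuousN.
Qed.

Lemma ReM (u v : R[i]) :
  complex.Re (u * v) = complex.Re u * complex.Re v - complex.Im u * complex.Im v.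
Proof. by case: u; case: v. Qed.

Lemma ImM (u v : R[i]) :
  complex.Im (u * v) = complex.Re u * complex.Im v + complex.Im u * complex.Re v.
Proof. by case: u => a b; case: v. Qed.

Lemma ccontM f g : ccont f x -> ccont g x -> ccont (fun y => f y * g y) x.
Proof.
move=> [f1 f2] [g1 g2]; split.
  apply: (cont_ext (fun y => ReM _ _)).
  by apply: continuousB; exact: continuousM.
apply: (cont_ext (fun y => ImM _ _)).
by apply: continuousD; exact: continuousM.
Qed.

Lemma ccontJ f : ccont f x -> ccont (fun y => Num.conj (f y)) x.
Proof.
move=> [f1 f2]; split.
  by apply: cont_ext f1 => y; case: (f y).
apply: (@cont_ext _ _ (fun y => - complex.Im (f y))) => [y|]; first by case: (f y).
exact: continuousN.
Qed.

Lemma ccontV f : f x != 0 -> ccont f x -> ccont (fun y => (f y)^-1) x.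
Proof.
move=> fx [f1 f2].
pose N y := complex.Re (f y) ^+ 2 + complex.Im (f y) ^+ 2.
have cN : {for x, continuous N}.
  by apply: continuousD; apply: (cont_ext (fun y => expr2 _)); exact: continuousM.
have N0 : N x != 0.
  apply: contra fx; rewrite /N paddr_eq0 ?sqr_ge0 // !sqrf_eq0.
  by rewrite eq_complex.
have cV := continuousV N0 cN.
split.
  apply: (@cont_ext _ _ (fun y => complex.Re (f y) * (N y)^-1)) => [y|].
    by rewrite /N; case: (f y).
  exact: continuousM.
apply: (@cont_ext _ _ (fun y => - complex.Im (f y) * (N y)^-1)) => [y|].
  by rewrite /N; case: (f y) => a b /=; rewrite mulNr.
by apply: continuousM => //; exact: continuousN.
Qed.

Lemma ccont_expi a : {for x, continuous a} -> ccont (fun y => expi (a y)) x.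
Proof.
move=> ca; have ca2 : {for x, continuous (fun y => 2 * pi * a y)}.
  by apply: continuousM => //; exact: cst_continuous.
split => /=.
  by apply: (continuous_comp ca2); exact: continuous_cos.
by apply: (continuous_comp ca2); exact: continuous_sin.
Qed.

Lemma ccont_sum (I : Type) (r : seq I) (P : pred I) (F : I -> T -> R[i]) :
  (forall i, P i -> ccont (F i) x) -> ccont (fun y => \sum_(i <- r | P i) F i y) x.
Proof.
move=> cF; elim: r => [|i r IH].
  by under eq_fun do rewrite big_nil; exact: ccont_cst.
under eq_fun do rewrite big_cons; have [Pi|//] := boolP (P i).
exact: (ccontD (cF i Pi)).
Qed.

Lemma ccont_prod (I : Type) (r : seq I) (P : pred I) (F : I -> T -> R[i]) :
  (forall i, P i -> ccont (F i) x) -> ccont (fun y => \prod_(i <- r | P i) F i y) x.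
Proof.
move=> cF; elim: r => [|i r IH].
  by under eq_fun do rewrite big_nil; exact: ccont_cst.
under eq_fun do rewrite big_cons; have [Pi|//] := boolP (P i).
exact: (ccontM (cF i Pi)).
Qed.

End Scalar.

Lemma ccont_comp (S T : topologicalType) (h : S -> T) (f : T -> R[i]) (x : S) :
  {for x, continuous h} -> ccont f (h x) -> ccont (fun y => f (h y)) x.
Proof.
move=> ch [f1 f2]; split; [exact: (continuous_comp ch f1) | exact: (continuous_comp ch f2)].
Qed.

Definition mcont (T : topologicalType) (p q : nat) (F : T -> 'M[R[i]]_(p, q)) (x : T) : Prop :=
  forall i j, ccont (fun y => F y i j) x.

Section Matrix.
Variables (T : topologicalType) (x : T).

Lemma mcont_cst p q (A : 'M[R[i]]_(p, q)) : mcont (fun _ => A) x.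
Proof. by move=> i j; exact: ccont_cst. Qed.

Lemma mcontD p q (F G : T -> 'M[R[i]]_(p, q)) :
  mcont F x -> mcont G x -> mcont (fun y => F y + G y) x.
Proof. by move=> cF cG i j; under eq_fun do rewrite mxE; exact: ccontD. Qed.

Lemma mcontN p q (F : T -> 'M[R[i]]_(p, q)) : mcont F x -> mcont (fun y => - F y) x.
Proof. by move=> cF i j; under eq_fun do rewrite mxE; exact: ccontN. Qed.

Lemma mcontB p q (F G : T -> 'M[R[i]]_(p, q)) :
  mcont F x -> mcont G x -> mcont (fun y => F y - G y) x.
Proof. by move=> cF cG; apply: mcontD => //; exact: mcontN. Qed.

Lemma mcontZ p q (a : T -> R[i]) (F : T -> 'M[R[i]]_(p, q)) :
  ccont a x -> mcont F x -> mcont (fun y => a y *: F y) x.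
Proof. by move=> ca cF i j; under eq_fun do rewrite mxE; exact: ccontM. Qed.

Lemma mcontM p q r (F : T -> 'M[R[i]]_(p, q)) (G : T -> 'M[R[i]]_(q, r)) :
  mcont F x -> mcont G x -> mcont (fun y => F y *m G y) x.
Proof.
move=> cF cG i j; under eq_fun do rewrite mxE.
by apply: ccont_sum => k _; exact: ccontM.
Qed.

Lemma mcontJ p q (F : T -> 'M[R[i]]_(p, q)) :
  mcont F x -> mcont (fun y => adjoint (F y)) x.
Proof. by move=> cF i j; under eq_fun do rewrite !mxE; exact: ccontJ. Qed.

Lemma ccont_det p (F : T -> 'M[R[i]]_p) : mcont F x -> ccont (fun y => \det (F y)) x.
Proof.
move=> cF; apply: ccont_sum => s _; apply: ccontM; first exact: ccont_cst.
by apply: ccont_prod => i _.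
Qed.

Lemma mcont_block p1 p2 q1 q2 (A : T -> 'M[R[i]]_(p1, q1)) (B : T -> 'M[R[i]]_(p1, q2))
    (C : T -> 'M[R[i]]_(p2, q1)) (D : T -> 'M[R[i]]_(p2, q2)) :
  mcont A x -> mcont B x -> mcont C x -> mcont D x ->
  mcont (fun y => block_mx (A y) (B y) (C y) (D y)) x.
Proof.
move=> cA cB cC cD i j; case: (split_ordP i) => i' ->; case: (split_ordP j) => j' ->.
- by under eq_fun do rewrite block_mxEul.
- by under eq_fun do rewrite block_mxEur.
- by under eq_fun do rewrite block_mxEdl.
- by under eq_fun do rewrite block_mxEdr.
Qed.

Lemma mcont_row_mx p q1 q2 (A : T -> 'M[R[i]]_(p, q1)) (B : T -> 'M[R[i]]_(p, q2)) :
  mcont A x -> mcont B x -> mcont (fun y => row_mx (A y) (B y)) x.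
Proof.
move=> cA cB i j; case: (split_ordP j) => j' ->.
- by under eq_fun do rewrite row_mxEl.
- by under eq_fun do rewrite row_mxEr.
Qed.

Lemma mcont_diag p (d : T -> 'rV[R[i]]_p) : mcont d x -> mcont (fun y => diag_mx (d y)) x.
Proof.
move=> cd i j; under eq_fun do rewrite mxE.
by case: (i == j) => //=; [under eq_fun do rewrite mulr1n|exact: ccont_cst].
Qed.

End Matrix.

Lemma mcont_comp (S T : topologicalType) p q (h : S -> T) (F : T -> 'M[R[i]]_(p, q)) (x : S) :
  {for x, continuous h} -> mcont F (h x) -> mcont (fun y => F (h y)) x.
Proof. by move=> ch cF i j; exact: (ccont_comp ch (cF i j)). Qed.

Lemma cont_sum (T : topologicalType) (x : T) (I : Type) (r : seq I) (P : pred I)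
    (F : I -> T -> R) :
  (forall i, P i -> {for x, continuous (F i)}) ->
  {for x, continuous (fun y => \sum_(i <- r | P i) F i y)}.
Proof.
move=> cF; elim: r => [|i r IH].
  by apply: (cont_ext (fun y => big_nil _ _ _ _)); exact: cst_continuous.
apply: (cont_ext (fun y => big_cons _ _ _ _ _ _)).
by have [Pi|//] := boolP (P i); exact: (continuousD (cF i Pi)).
Qed.

(** Retraction of the line onto [[0, l]]. Composing with it turns a path that is only known on
    [[0, l]] into one that is continuous everywhere; with [l = 1] it is the ramp function of
    [polygon]. *)
Definition clamp (l t : R) : R := Num.max 0 (Num.min t l).

Lemma clamp_itv (l t : R) : 0 <= l -> 0 <= clamp l t <= l.
Proof. by move=> l0; rewrite /clamp le_max lexx /= ge_max l0 ge_min lexx orbT. Qed.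

Lemma clamp_id (l t : R) : 0 <= t <= l -> clamp l t = t.
Proof. by move=> /andP[t0 tl]; rewrite /clamp (min_idPl tl) (max_idPr t0). Qed.

Lemma continuous_clamp (l : R) : continuous (clamp l).
Proof.
move=> t; rewrite /clamp; apply: (@continuous_max _ _ (fun _ => 0) (fun t => Num.min t l)).
  exact: cst_continuous.
by apply: (@continuous_min _ _ id (fun _ => l)); [exact: cvg_id|exact: cst_continuous].
Qed.

Lemma continuous_comp_clamp (l : R) (f : R -> R) : 0 <= l ->
  {within `[0, l], continuous f} -> continuous (fun t => f (clamp l t)).
Proof.
move=> l0 /subspace_continuousP cf t.
apply: cvg_trans (cf (clamp l t) _); last first.
  by rewrite /= in_itv /= clamp_itv.
move=> A /= [e /= e0 eA].
have : \forall y \near t, ball (clamp l t) e (clamp l y).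
  by apply: (continuous_clamp (x := t)); exact: nbhsx_ballx.
apply: filterS => y ye; apply: eA => //=.
by rewrite in_itv /= clamp_itv.
Qed.

(** Compactness of [[0, l]] makes a property that is local around the diagonal uniform. The bound is
    the mesh of a subdivision into [N.+1] equal steps, the form in which [arg_lift] and [loop_split]
    use it. *)
Lemma lebesgue_number (l : R) (P : R -> R -> Prop) : 0 < l ->
  (forall x, 0 <= x <= l -> \forall p \near (x, x), P p.1 p.2) ->
  exists N : nat, forall y z, 0 <= y <= l -> `|y - z| <= l / N.+1%:R -> P y z.
Proof.
move=> l0 locP.
have := @segment_compact R 0 l; rewrite compact_near_coveringP.
move=> /(_ R (0^'+) (fun e y => forall z, `|y - z| < e -> P y z)) [].
  move=> x; rewrite /= in_itv /= => /locP [[A B] /= [[a /= a0 aA] [b /= b0 bB]] AB].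
  have d0 : 0 < Num.min a (b / 2) by rewrite lt_min a0 divr_gt0.
  exists (ball x (Num.min a (b / 2)), [set e | e < b / 2]).
    split => /=; first exact: nbhsx_ballx.
    by apply: nbhs_right_lt; rewrite divr_gt0.
  move=> [y e] /= [yx eb] z yz; apply: (AB (y, z)); split => /=.
    by apply: aA; move: yx; rewrite /ball /= => h; rewrite (lt_le_trans h) // ge_min lexx.
  apply: bB => /=; move: yx; rewrite /ball /= => h.
  have h2 : `|x - y| < b / 2 by rewrite (lt_le_trans h) // ge_min lexx orbT.
  rewrite -(subrKA y x (- z)) (le_lt_trans (ler_normD _ _)) //; lra.
move=> d /= d0 dP.
have [N _ NP] : exists2 N : nat, True & l / N.+1%:R < d / 2.
  exists (Num.truncn (l / (d / 2))) => //.
  rewrite ltr_pdivrMr // mulrC -ltr_pdivrMr ?divr_gt0 //.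
  exact: Num.Theory.truncnS_gt.
exists N => y z yl yz.
have : (fun e : R => `[0, l]%classic `<=` [set y | forall z, `|y - z| < e -> P y z]) (d / 2).
  by apply: dP; rewrite /= ?sub0r ?normrN ?gtr0_norm //; lra.
by move=> /(_ y); rewrite /= in_itv /=; apply; rewrite ?(le_lt_trans yz).
Qed.

End Continuity.

(** * Continuous arguments and polygonal approximation *)

Section Paths.
Variable R : realType.
Implicit Types l t : R.

(** On a fine subdivision, values of [u] at most one step apart have a quotient in the right
    half-plane, where the arctangent is a continuous argument. The lift is a finite sum of such
    arguments. *)
Lemma arg_lift l (u : R -> R[i]) : 0 < l ->
  (forall t, 0 <= t <= l -> ccont u t /\ u t != 0) ->
  exists phi : R -> R, (forall t, 0 <= t <= l -> {for t, continuous phi}) /\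
    forall t, 0 <= t <= l -> exists r : R, 0 < r /\ u t = r%:C * expi (phi t).
Proof.
move=> l0 cu.
have [N NP] : exists N : nat, forall y z, 0 <= y <= l -> `|y - z| <= l / N.+1%:R ->
    0 < complex.Re (u z / u y).
  apply: (@lebesgue_number _ _ (fun y z => 0 < complex.Re (u z / u y))) => // x xl.
  have [cx ux] := cu x xl.
  have cq : ccont (fun p : R * R => u p.2 / u p.1) (x, x).
    have c1 : {for (x, x), continuous (@fst R R)} by exact: cvg_fst.
    have c2 : {for (x, x), continuous (@snd R R)} by exact: cvg_snd.
    exact: (ccontM (ccont_comp c2 cx) (ccontV ux (ccont_comp c1 cx))).
  apply: (cvgr_gt _ cq.1); rewrite /= mulfV //=; exact: ltr01.
pose T j := j%:R * (l / N.+1%:R).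
have eta0 : 0 < l / N.+1%:R by rewrite divr_gt0.
have T_S j : T j.+1 = T j + l / N.+1%:R by rewrite /T -natr1 mulrDl mul1r.
have T_ge0 j : 0 <= T j by rewrite mulr_ge0 // ltW.
(* [u] is stopped at the node [T j]. The quotients of successive stopped paths telescope to
   [u t / u 0], and each is continuous on the whole interval, so that no pieces have to be glued. *)
pose v j t := u (Num.min t (T j)).
pose carg (z : R[i]) := atan (complex.Im z / complex.Re z) / (2 * pi).
have [_ u0] := cu 0 (introT andP (conj (lexx 0) (ltW l0))).
have [r0 [x0 [r0_gt0 u0E]]] := polar u0.
have min_itv j t : 0 <= t <= l -> 0 <= Num.min t (T j) <= l.
  by move=> /andP[t0 tl]; rewrite le_min t0 T_ge0 ge_min tl.
have v_neq0 j t : 0 <= t <= l -> v j t != 0.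
  by move=> tl; have [] := cu _ (min_itv j t tl).
have v_pos j t : 0 <= t <= l -> 0 < complex.Re (v j.+1 t / v j t).
  move=> tl; apply: NP; first exact: min_itv.
  have [tj|/ltW tj] := leP t (T j).
    have tj1 : t <= T j.+1 by rewrite T_S ler_wpDr // ltW.
    by rewrite (min_idPl tj1) subrr normr0 ltW.
  have [tj1|tj1] := leP t (T j.+1); last first.
    by rewrite T_S opprD addrA subrr sub0r normrN gtr0_norm.
  by rewrite distrC ger0_norm ?subr_ge0 // lerBlDl -T_S.
exists (fun t => x0 + \sum_(j < N.+1) carg (v j.+1 t / v j t)); split=> t tl.
  apply: continuousD; first exact: cst_continuous.
  apply: cont_sum => j _.
  have cv k : ccont (v k) t.
    apply: (@ccont_comp _ _ _ (fun t => Num.min t (T k))).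
      by apply: (@continuous_min _ _ id (fun _ => T k)); [exact: cvg_id|exact: cst_continuous].
    by have [] := cu _ (min_itv k t tl).
  have [cR cI] := ccontM (cv j.+1) (ccontV (v_neq0 j t tl) (cv j)).
  apply: continuousM; last exact: cst_continuous.
  apply: (@continuous_comp _ _ _ (fun y => complex.Im (v j.+1 y / v j y) /
     complex.Re (v j.+1 y / v j y)) (@atan R)).
    by apply: continuousM => //; apply: continuousV => //; rewrite gt_eqF ?v_pos.
  exact: continuous_atan.
have carg_polar j : exists r : R, 0 < r /\
    v j.+1 t / v j t = r%:C * expi (carg (v j.+1 t / v j t)).
  have := v_pos j t tl; rewrite /carg; case: (_ / _) => a b /=.
  by move=> /(polarD b)[r]; exists r.
have [r rP] := boolp.choice carg_polar.
exists (r0 * \prod_(j < N.+1) r j); split.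
  by rewrite mulr_gt0 //; apply: prodr_gt0 => j _; case: (rP j).
have vl : v N.+1 t = u t.
  rewrite /v (min_idPl _) // /T mulrC divfK //.
  by case/andP: tl.
have v0 : v 0%N t = u 0 by rewrite /v /T mul0r (min_idPr _) //; case/andP: tl.
have := @telescope_prodf _ 0%N N.+1 (fun j => v j t) (fun j _ => v_neq0 j t tl).
rewrite vl v0 big_mkord => /(_ isT) E.
rewrite -[LHS](divfK u0) -E u0E expiD expi_sum rmorphM rmorph_prod /=.
under eq_bigr => j _ do rewrite (rP j).2.
rewrite big_split /=.
set a := \prod_(_ < _) _; set b := \prod_(_ < _) _; ring.
Qed.

(** Piecewise linear interpolation of [c] between equidistant nodes, written as a sum of increments
    multiplied by ramps, so that continuity is immediate. *)
Definition polygon n l N (c : R -> 'cV[R[i]]_n) (t : R) : 'cV[R[i]]_n :=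
  let eta := l / N.+1%:R in
  c 0 + \sum_(0 <= j < N.+1) (clamp 1 ((t - j%:R * eta) / eta))%:C *:
          (c (j.+1%:R * eta) - c (j%:R * eta)).

Lemma polygon_cont n l N (c : R -> 'cV[R[i]]_n) t : mcont (polygon l N c) t.
Proof.
apply: mcontD; first exact: mcont_cst.
move=> i k; under eq_fun do rewrite summxE.
apply: ccont_sum => j _; under eq_fun do rewrite mxE.
apply: ccontM; last exact: ccont_cst.
apply: ccont_real; apply: (@continuous_comp _ _ _ _ (clamp 1)).
  apply: continuousM; last exact: cst_continuous.
  by apply: continuousB; [exact: cvg_id|exact: cst_continuous].
exact: continuous_clamp.
Qed.

Lemma polygonE n l N (c : R -> 'cV[R[i]]_n) t : 0 < l -> 0 <= t <= l ->
  let eta := l / N.+1%:R in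
  exists (j : 'I_N.+1) (s : R),
  [/\ 0 <= s <= 1, t = (j%:R + s) * eta &
      polygon l N c t = (1 - s)%:C *: c (j%:R * eta) + s%:C *: c (j.+1%:R * eta)].
Proof.
move=> l0 /andP[t0 tl] eta.
have eta0 : 0 < eta by rewrite divr_gt0.
have [j [s [s01 tE]]] : exists (j : 'I_N.+1) (s : R), 0 <= s <= 1 /\ t = (j%:R + s) * eta.
  (* At [t = l] the truncated quotient would be [N.+1], out of range: the last segment is taken with
     [s = 1]. *)
  have [tl'|lt] := ltP t l; last first.
    have -> : t = l by apply/eqP; rewrite eq_le tl.
    exists ord_max, 1; split; first by lra.
    by rewrite natr1 /eta mulrC divfK.
  have te : 0 <= t / eta by rewrite divr_ge0 // ltW.
  have jN : (Num.truncn (t / eta) < N.+1)%N.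
    by rewrite truncn_lt_nat // ltr_pdivrMr // /eta mulrC divfK.
  exists (Ordinal jN), (t / eta - (Num.truncn (t / eta))%:R); split; last first.
    by rewrite addrC subrK divfK // gt_eqF.
  have /andP[] := truncn_itv te; rewrite -natr1 /=; lra.
exists j, s; split=> //.
(* The ramps before [j] have reached 1 and their increments telescope, those after [j] are still 0,
   and only ramp [j] is partial. *)
rewrite /polygon -/eta (big_cat_nat _ (n := j)) //=; last by rewrite ltnW.
rewrite [X in _ + (_ + X)]big_ltn //.
rewrite [X in _ + (_ + (_ + X))]big1_seq; last first.
  move=> k; rewrite mem_index_iota => /andP[_ /andP[jk _]].
  rewrite (_ : clamp _ _ = 0) ?scale0r //.
  rewrite /clamp (max_idPl _) // ge_min; apply/orP; left.
  rewrite pmulr_lle0 ?invr_gt0 // tE -mulrBl pmulr_lle0 //.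
  have : j.+1%:R <= k%:R :> R by rewrite ler_nat.
  by rewrite -natr1; lra.
rewrite addr0 tE -mulrBl mulfK ?gt_eqF // addrAC subrr add0r clamp_id //.
rewrite (eq_big_nat _ _ (F2 := fun k => c (k.+1%:R * eta) - c (k%:R * eta))); last first.
  move=> k /andP[_ kj].
  rewrite -mulrBl mulfK ?gt_eqF //.
  rewrite (_ : clamp _ _ = 1) ?scale1r //.
  have : k.+1%:R <= j%:R :> R by rewrite ler_nat.
  rewrite -natr1 /clamp => ?; rewrite (min_idPr _) ?(max_idPr _) //; lra.
rewrite telescope_sumr // mul0r addrA [c 0 + _]addrC subrK.
by rewrite rmorphB rmorph1 /= scalerBl scale1r scalerBr addrAC !addrA.
Qed.

Lemma polygon0 n l N (c : R -> 'cV[R[i]]_n) : 0 < l -> polygon l N c 0 = c 0.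
Proof.
move=> l0; have eta0 : 0 < l / N.+1%:R by rewrite divr_gt0.
rewrite /polygon big1_seq ?addr0 // => j _.
rewrite (_ : clamp _ _ = 0) ?scale0r // /clamp (max_idPl _) // ge_min.
by rewrite sub0r mulNr mulfK ?gt_eqF // oppr_le0 ler0n.
Qed.

Lemma polygonl n l N (c : R -> 'cV[R[i]]_n) : 0 < l -> polygon l N c l = c l.
Proof.
move=> l0; have eta0 : 0 < l / N.+1%:R by rewrite divr_gt0.
have lE : N.+1%:R * (l / N.+1%:R) = l by rewrite mulrC divfK.
rewrite /polygon (eq_big_nat _ _
   (F2 := fun k => c (k.+1%:R * (l / N.+1%:R)) - c (k%:R * (l / N.+1%:R)))).
  by rewrite telescope_sumr // mul0r lE addrC subrK.
move=> j /andP[_ jN].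
rewrite (_ : clamp _ _ = 1) ?scale1r // /clamp.
rewrite -{1}lE -mulrBl mulfK ?gt_eqF //.
have : j.+1%:R <= N.+1%:R :> R by rewrite ler_nat.
rewrite -natr1 => ?; rewrite (min_idPr _) ?(max_idPr _) //; lra.
Qed.

End Paths.

(** * Unitary matrices and rotations between unit vectors *)

Section Unitary.
Variable R : realType.
Local Notation C := R[i].

Lemma adjointM p q r (A : 'M[C]_(p, q)) (B : 'M[C]_(q, r)) :
  adjoint (A *m B) = adjoint B *m adjoint A.
Proof. by rewrite /adjoint map_mxM trmx_mul. Qed.

Lemma adjointK p q (A : 'M[C]_(p, q)) : adjoint (adjoint A) = A.
Proof. by apply/matrixP => i j; rewrite !mxE conjCK. Qed.

Lemma adjointD p q (A B : 'M[C]_(p, q)) : adjoint (A + B) = adjoint A + adjoint B.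
Proof. by rewrite /adjoint map_mxD linearD. Qed.

Lemma adjointN p q (A : 'M[C]_(p, q)) : adjoint (- A) = - adjoint A.
Proof. by rewrite /adjoint map_mxN linearN. Qed.

Lemma adjointZ p q a (A : 'M[C]_(p, q)) : adjoint (a *: A) = Num.conj a *: adjoint A.
Proof. by apply/matrixP => i j; rewrite !mxE rmorphM. Qed.

Lemma adjoint1 n : adjoint (1%:M : 'M[C]_n) = 1%:M.
Proof. by rewrite /adjoint map_mx1 trmx1. Qed.

Lemma adjoint0 p q : adjoint (0 : 'M[C]_(p, q)) = 0.
Proof. by rewrite /adjoint map_mx0 trmx0. Qed.

Lemma adjoint_block p1 p2 q1 q2 (A : 'M[C]_(p1, q1)) (B : 'M[C]_(p1, q2))
    (D : 'M[C]_(p2, q1)) (E : 'M[C]_(p2, q2)) :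
  adjoint (block_mx A B D E) = block_mx (adjoint A) (adjoint D) (adjoint B) (adjoint E).
Proof. by rewrite /adjoint map_block_mx tr_block_mx. Qed.

Definition unitary n (A : 'M[C]_n) : Prop := adjoint A *m A = 1%:M.

Lemma unitaryC n (A : 'M[C]_n) : unitary A -> A *m adjoint A = 1%:M.
Proof. exact: mulmx1C. Qed.

Lemma unitaryM n (A B : 'M[C]_n) : unitary A -> unitary B -> unitary (A *m B).
Proof.
by rewrite /unitary => uA uB; rewrite adjointM mulmxA -[X in X *m _]mulmxA uA mulmx1.
Qed.

Lemma unitaryJ n (A : 'M[C]_n) : unitary A -> unitary (adjoint A).
Proof. by move=> uA; rewrite /unitary adjointK unitaryC. Qed.

Lemma unitary1 n : unitary (1%:M : 'M[C]_n).
Proof. by rewrite /unitary adjoint1 mulmx1. Qed.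

Lemma unitary_block1 n (A : 'M[C]_n) :
  unitary A -> unitary (block_mx (1%:M : 'M[C]_1) 0 0 A).
Proof.
rewrite /unitary => uA; rewrite adjoint_block !adjoint0 adjoint1 mulmx_block uA.
by rewrite !mulmx0 !mul0mx !mulmx1 !addr0 add0r -scalar_mx_block.
Qed.

Lemma det_adjoint n (A : 'M[C]_n) : \det (adjoint A) = Num.conj (\det A).
Proof. by rewrite /adjoint det_tr det_map_mx. Qed.

Lemma det_unitary n (A : 'M[C]_n) : unitary A -> Num.conj (\det A) * \det A = 1.
Proof. by move=> uA; rewrite -det_adjoint -det_mulmx uA det1. Qed.

Lemma unitary_diag_expi n (x : 'I_n -> R) : unitary (diag_mx (\row_j expi (x j))).
Proof.
rewrite /unitary; apply/matrixP => i j; rewrite mul_mx_diag !mxE.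
case: eqVneq => [->|ij].
  by rewrite ?eqxx !mulr1n conj_expi -expiD addNr expi0.
by rewrite 1?eq_sym ?(negPf ij) !mulr0n rmorph0 mul0r.
Qed.

Definition dotc n (u v : 'cV[C]_n) : C := (adjoint u *m v) 0 0.

Lemma dotcE n (u v : 'cV[C]_n) : dotc u v = \sum_i Num.conj (u i 0) * v i 0.
Proof. by rewrite /dotc mxE; apply: eq_bigr => i _; rewrite !mxE. Qed.

Lemma dotcDl n (u v x : 'cV[C]_n) : dotc (u + v) x = dotc u x + dotc v x.
Proof. by rewrite /dotc adjointD mulmxDl mxE. Qed.

Lemma dotcDr n (u v x : 'cV[C]_n) : dotc x (u + v) = dotc x u + dotc x v.
Proof. by rewrite /dotc mulmxDr mxE. Qed.

Lemma dotcZl n a (u v : 'cV[C]_n) : dotc (a *: u) v = Num.conj a * dotc u v.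
Proof. by rewrite /dotc adjointZ -scalemxAl mxE. Qed.

Lemma dotcZr n a (u v : 'cV[C]_n) : dotc u (a *: v) = a * dotc u v.
Proof. by rewrite /dotc -scalemxAr mxE. Qed.

Lemma conj_dotc n (u v : 'cV[C]_n) : Num.conj (dotc u v) = dotc v u.
Proof.
rewrite !dotcE rmorph_sum; apply: eq_bigr => i _.
by rewrite rmorphM /= conjCK mulrC.
Qed.

Lemma dotc_unitary n (A : 'M[C]_n) (u v : 'cV[C]_n) :
  unitary A -> dotc (A *m u) (A *m v) = dotc u v.
Proof. by move=> uA; rewrite /dotc adjointM -mulmxA [adjoint A *m _]mulmxA uA mul1mx. Qed.

Lemma dotcc n (v : 'cV[C]_n) : dotc v v = (sqnorm v)%:C.
Proof.
rewrite dotcE /sqnorm rmorph_sum; apply: eq_bigr => i _ /=.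
rewrite -mulrC; case: (v i 0) => a b; apply/eqP; rewrite eq_complex /=.
by apply/andP; split; apply/eqP; ring.
Qed.

Lemma sqnorm_ge0 n (v : 'cV[C]_n) : 0 <= sqnorm v.
Proof. by apply: sumr_ge0 => i _; rewrite addr_ge0 ?sqr_ge0. Qed.

Lemma sqnorm_eq0 n (v : 'cV[C]_n) : (sqnorm v == 0) = (v == 0).
Proof.
apply/idP/eqP => [|->]; last first.
  by rewrite /sqnorm big1 // => i _; rewrite mxE /= expr0n addr0.
rewrite /sqnorm psumr_eq0 => [/allP v0|i _]; last by rewrite addr_ge0 ?sqr_ge0.
apply/matrixP => i j; rewrite mxE (ord1 j).
have := v0 i (mem_index_enum i); rewrite paddr_eq0 ?sqr_ge0 // !sqrf_eq0 => /andP[a b].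
by apply/eqP; rewrite eq_complex a b.
Qed.

Lemma sqnorm_gt0 n (v : 'cV[C]_n) : (0 < sqnorm v) = (v != 0).
Proof. by rewrite lt_def sqnorm_eq0 sqnorm_ge0 andbT. Qed.

Definition normalize n (v : 'cV[C]_n) : 'cV[C]_n := (Num.sqrt (sqnorm v))^-1%:C *: v.

Lemma dotc_normalize n (v : 'cV[C]_n) : v != 0 -> dotc (normalize v) (normalize v) = 1.
Proof.
rewrite -sqnorm_gt0 => v0; rewrite dotcZl dotcZr dotcc [Num.conj _]conjc_real.
have s0 : Num.sqrt (sqnorm v) != 0 by rewrite gt_eqF ?sqrtr_gt0.
rewrite -!rmorphM /= mulrA -{3}[sqnorm v]sqr_sqrtr ?ltW // expr2.
by rewrite (_ : _ * _ = 1) ?rmorph1 //; field.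
Qed.

Lemma normalize_unit n (v : 'cV[C]_n) : dotc v v = 1 -> normalize v = v.
Proof.
by rewrite dotcc => /complexI v1; rewrite /normalize v1 sqrtr1 invr1 scale1r.
Qed.

Lemma normalizeE n (v : 'cV[C]_n) : v != 0 ->
  v = (Num.sqrt (sqnorm v))%:C *: normalize v.
Proof.
rewrite -sqnorm_gt0 => v0; rewrite scalerA -rmorphM mulfV ?rmorph1 ?scale1r //.
by rewrite gt_eqF ?sqrtr_gt0.
Qed.

(** Fixes the vectors orthogonal to [a]. For nonzero [b] it is unitary as soon as twice the real
    part of [b] is the squared norm of [a]; for [b = dotc a u] it sends [u] to [u - a]. *)
Definition reflection n (b : C) (a : 'cV[C]_n) : 'M[C]_n :=
  1%:M - b^-1 *: (a *m adjoint a).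

Lemma reflection_unitary n b (a : 'cV[C]_n) :
  b != 0 -> b + Num.conj b = dotc a a -> unitary (reflection b a).
Proof.
move=> b0 baa; have cb0 : Num.conj b != 0 by rewrite fmorph_eq0.
rewrite /unitary /reflection adjointD adjointN adjoint1 adjointZ adjointM adjointK.
rewrite mulmxBl mul1mx mulmxBr mulmx1 -scalemxAl -scalemxAr.
have -> : a *m adjoint a *m (a *m adjoint a) = dotc a a *: (a *m adjoint a).
  rewrite mulmxA -[a *m adjoint a *m a]mulmxA [adjoint a *m a]mx11_scalar -/(dotc a a).
  by rewrite mul_mx_scalar scalemxAl.
rewrite -baa fmorphV /=; move: (a *m adjoint a) => M.
by apply/matrixP => i j; rewrite !mxE; field; rewrite b0 cb0.
Qed.

Lemma reflection_mul n b (a u : 'cV[C]_n) :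
  reflection b a *m u = u - (b^-1 * dotc a u) *: a.
Proof.
rewrite /reflection mulmxBl mul1mx -scalemxAl -mulmxA [adjoint a *m u]mx11_scalar.
by rewrite -/(dotc a u) mul_mx_scalar scalerA.
Qed.

(* A product of two complex reflections, u |-> - u |-> v, which unlike a single
   one is continuous at v = u. *)
Definition rotation n (u v : 'cV[C]_n) : 'M[C]_n :=
  reflection (1 + dotc v u) (u + v) *m reflection 2^-1 u.

Lemma rotation_unitary n (u v : 'cV[C]_n) :
  dotc u u = 1 -> dotc v v = 1 -> 1 + dotc v u != 0 -> unitary (rotation u v).
Proof.
move=> u1 v1 uv; apply: unitaryM; apply: reflection_unitary => //.
- by rewrite rmorphD rmorph1 /= conj_dotc !dotcDl !dotcDr u1 v1; ring.
- by rewrite fmorphV rmorph_nat u1; field.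
Qed.

Lemma rotation_mul n (u v : 'cV[C]_n) :
  dotc u u = 1 -> 1 + dotc v u != 0 -> rotation u v *m u = v.
Proof.
move=> u1 uv; rewrite /rotation -mulmxA [reflection 2^-1 u *m u]reflection_mul u1 invrK mulr1.
rewrite scaler_nat mulr2n opprD addNKr mulmxN reflection_mul dotcDl u1.
by rewrite mulVf // scale1r opprB addrAC subrr add0r.
Qed.

Lemma rotation1 n (u : 'cV[C]_n) : dotc u u = 1 -> rotation u u = 1%:M.
Proof.
move=> u1; have r1 : unitary (reflection 2^-1 u).
  apply: reflection_unitary; first by rewrite invr_eq0 pnatr_eq0.
  by rewrite fmorphV rmorph_nat u1; field.
have rJ : adjoint (reflection 2^-1 u) = reflection 2^-1 u.
  rewrite /reflection adjointD adjointN adjoint1 adjointZ adjointM adjointK.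
  by rewrite !fmorphV rmorph_nat.
have r2 : reflection (1 + dotc u u) (u + u) = reflection 2^-1 u.
  rewrite /reflection u1 (_ : u + u = 2 *: u); last by rewrite scaler_nat mulr2n.
  rewrite -scalemxAl adjointZ -scalemxAr rmorph_nat !scalerA.
  by congr (_ - _ *: _); field.
by rewrite /rotation r2 -{1}rJ; exact: r1.
Qed.

(** The domain on which [turn u v] is well behaved: [k = 0] keeps [v] nonzero, and the other values
    of [k] keep the denominator [1 + dotc (normalize v) u] nonzero. *)
Definition off_ray n (u v : 'cV[C]_n) : Prop :=
  forall k : R, 0 <= k -> v != (- k)%:C *: u.

Lemma off_ray_neq0 n (u v : 'cV[C]_n) : off_ray u v -> v != 0.
Proof. by move=> /(_ 0 (lexx _)); rewrite oppr0 scale0r. Qed.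

(** Equality case of Cauchy-Schwarz: unit vectors with product -1 have a sum of norm 0, hence are
    opposite. *)
Lemma off_rayP n (u v : 'cV[C]_n) :
  dotc u u = 1 -> off_ray u v -> 1 + dotc (normalize v) u != 0.
Proof.
move=> u1 uv; have v0 := off_ray_neq0 uv; have v1 := dotc_normalize v0.
apply: contra (uv (Num.sqrt (sqnorm v)) (sqrtr_ge0 _)); set w := normalize v => /eqP E.
have : dotc (w + u) (w + u) = 0.
  have E2 : Num.conj (1 + dotc w u) = 0 by rewrite E rmorph0.
  move: E2; rewrite rmorphD rmorph1 /= conj_dotc => E2.
  rewrite !dotcDl !dotcDr v1 u1; transitivity ((1 + dotc w u) + (1 + dotc u w)); first by ring.
  by rewrite E E2 addr0.
rewrite dotcc => /eqP; rewrite fmorph_eq0 sqnorm_eq0 addr_eq0 => /eqP wu.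
by rewrite {1}(normalizeE v0) -/w wu scalerN rmorphN scaleNr.
Qed.

Definition turn n (u v : 'cV[C]_n) : 'M[C]_n := rotation u (normalize v).

Lemma turn_unitary n (u v : 'cV[C]_n) : dotc u u = 1 -> off_ray u v -> unitary (turn u v).
Proof.
move=> u1 uv; apply: rotation_unitary => //; last exact: off_rayP.
exact/dotc_normalize/(off_ray_neq0 uv).
Qed.

Lemma turn_mul n (u v : 'cV[C]_n) :
  dotc u u = 1 -> off_ray u v -> turn u v *m u = normalize v.
Proof. by move=> u1 uv; apply: rotation_mul => //; exact: off_rayP. Qed.

Lemma turn1 n (u : 'cV[C]_n) : dotc u u = 1 -> turn u u = 1%:M.
Proof. by move=> u1; rewrite /turn normalize_unit // rotation1. Qed.

Section Cont.
Variables (T : topologicalType) (x : T) (n : nat).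
Implicit Types u v : T -> 'cV[C]_n.

Lemma dotc_cont u v : mcont u x -> mcont v x -> ccont (fun y => dotc (u y) (v y)) x.
Proof. by move=> cu cv; apply: mcontM => //; exact: mcontJ. Qed.

Lemma mcont_normalize v : v x != 0 -> mcont v x -> mcont (fun y => normalize (v y)) x.
Proof.
move=> v0 cv; apply: mcontZ => //; apply: ccont_real; apply: continuousV.
  by rewrite gt_eqF // sqrtr_gt0 sqnorm_gt0.
apply: (continuous_comp (f := fun y => sqnorm (v y))); last exact: sqrt_continuous.
apply: cont_sum => i _; have [cR cI] := cv i 0.
apply: continuousD; apply: (cont_ext (fun y => expr2 _)); exact: continuousM.
Qed.

Lemma mcont_reflection (b : T -> C) u :
  b x != 0 -> ccont b x -> mcont u x -> mcont (fun y => reflection (b y) (u y)) x.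
Proof.
move=> b0 cb cu; apply: mcontB; first exact: mcont_cst.
apply: mcontZ; first exact: ccontV.
by apply: mcontM => //; exact: mcontJ.
Qed.

Lemma mcont_turn u v : dotc (u x) (u x) = 1 -> off_ray (u x) (v x) ->
  mcont u x -> mcont v x -> mcont (fun y => turn (u y) (v y)) x.
Proof.
move=> u1 uv cu cv; have cw := mcont_normalize (off_ray_neq0 uv) cv.
apply: mcontM; apply: mcont_reflection => //.
- exact: off_rayP.
- by apply: ccontD; [exact: ccont_cst|exact: dotc_cont].
- exact: mcontD.
- exact: ccont_cst.
Qed.

End Cont.

End Unitary.

(** * Homotopies of unitary paths *)

Section Avoid.
Variable R : realType.
Local Notation C := R[i].

Lemma exists_nonroot (p : {poly R}) : p != 0 -> exists x, ~~ root p x.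
Proof.
move=> p0; pose s := [seq i%:R : R | i <- iota 0 (size p)].
have /allPn[x _ px] : ~~ all (root p) s.
  apply/negP => /(max_poly_roots p0).
  rewrite map_inj_uniq ?iota_uniq => [/(_ isT)|i j]; last first.
    by move/eqP; rewrite eqr_nat => /eqP.
  by rewrite size_map size_iota ltnn.
by exists x.
Qed.

(** The first two complex coordinates project everything to real dimension 4, where each real plane
    is killed by a nonzero linear form [k j]. It remains to find a point on which none of these
    finitely many forms vanishes. *)
Lemma avoid_planes n N (a b : 'I_N -> 'cV[C]_n.+2) :
  exists v : 'cV[C]_n.+2, forall j (x y : R), v != x%:C *: a j + y%:C *: b j.
Proof.
pose o1 : 'I_n.+2 := lift 0 0.
pose rc (v : 'cV[C]_n.+2) : 'rV[R]_4 := \row_k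
  nth 0 [:: complex.Re (v 0 0); complex.Im (v 0 0); complex.Re (v o1 0); complex.Im (v o1 0)] k.
have rcD (u v : 'cV[C]_n.+2) (x y : R) : rc (x%:C *: u + y%:C *: v) = x *: rc u + y *: rc v.
  apply/rowP => k; rewrite !mxE.
  have reE (z z' : C) : complex.Re (x%:C * z + y%:C * z') = x * complex.Re z + y * complex.Re z'.
    by case: z; case: z' => c d e f /=; rewrite !mul0r !subr0.
  have imE (z z' : C) : complex.Im (x%:C * z + y%:C * z') = x * complex.Im z + y * complex.Im z'.
    by case: z; case: z' => c d e f /=; rewrite !mul0r !addr0.
  by case: k => -[|[|[|[|//]]]] /= _; rewrite ?reE ?imE.
pose M j : 'M[R]_(4, 1 + 1) := row_mx (rc (a j))^T (rc (b j))^T.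
pose k j := nz_row (kermx (M j)).
have k0 j : k j != 0.
  rewrite nz_row_eq0 -mxrank_eq0 mxrank_ker subn_eq0 -ltnNge.
  by rewrite (leq_ltn_trans (rank_leq_col _)).
have kM j : k j *m M j = 0 by apply/sub_kermxP; exact: nz_row_sub.
have [|x] := @exists_nonroot (\prod_j rVpoly (k j)).
  by apply/prodf_neq0 => j _; apply: contra (k0 j) => /eqP E; rewrite -[k j]rVpolyK E linear0.
rewrite rootE horner_prod => /prodf_neq0 xroot.
(* A point of the moment curve (1, x, x^2, x^3): the form [k j] takes there the value at [x] of the
   polynomial with the same coefficients, and [x] is a root of none of them. *)
pose v : 'cV[C]_n.+2 := \col_i (if i == 0 then 1 +i* x else x ^+ 2 +i* x ^+ 3).
exists v => j y z; apply: contra (xroot j isT) => /eqP E.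
have rv : rc v = \row_(i < 4) x ^+ i.
  by apply/rowP => -[[|[|[|[|//]]]]] i; rewrite !mxE /= ?expr1.
suff <- : (k j *m (rc v)^T) 0 0 = (rVpoly (k j)).[x].
  move: (kM j); rewrite /M mul_mx_row -[RHS](@row_mx0 R 1 1 1) => /eq_row_mx[ka kb].
  by rewrite E rcD linearD !linearZ /= mulmxDr -!scalemxAr ka kb !scaler0 addr0 mxE.
rewrite (@horner_coef_wide _ 4) ?size_poly // mxE; apply: eq_bigr => i _.
by rewrite coef_rVpoly_ord rv !mxE.
Qed.

End Avoid.

Section Loops.
Variables (R : realType) (l : R).
Hypothesis l0 : 0 < l.
Local Notation C := R[i].
Local Notation e0 := (delta_mx 0 0 : 'cV[C]__).

(** Free homotopy: the base point may move with [s]. It is brought back only at the end, in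
    [path_homotopy]. *)
Definition loop_homotopic n (P Q : R -> 'M[C]_n) : Prop :=
  exists H : R * R -> 'M[C]_n,
  [/\ forall s t, 0 <= s <= 1 -> 0 <= t <= l -> mcont H (s, t),
      forall s t, 0 <= s <= 1 -> 0 <= t <= l -> unitary (H (s, t)),
      forall t, 0 <= t <= l -> H (0, t) = P t /\ H (1, t) = Q t
    & forall s, 0 <= s <= 1 -> H (s, 0) = H (s, l)].

Definition unitary_path n (P : R -> 'M[C]_n) : Prop :=
  forall t, 0 <= t <= l -> mcont P t /\ unitary (P t).

Let zl : 0 <= (0 : R) <= l. Proof. by rewrite lexx ltW. Qed.
Let ll : 0 <= l <= l. Proof. by rewrite lexx ltW. Qed.
Let o1 : 0 <= (1 : R) <= 1. Proof. by rewrite lexx ler01. Qed.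

(** The adjoint of a unitary matrix fixes the same vectors, so the first row is trivial together
    with the first column. *)
Lemma unitary_fix_e0 n (E : 'M[C]_(1 + n)) : unitary E -> E *m e0 = e0 ->
  E = block_mx 1%:M 0 0 (drsubmx E) /\ unitary (drsubmx E).
Proof.
move=> uE Ee.
have Ee' : adjoint E *m e0 = e0 by rewrite -{1}Ee mulmxA uE mul1mx.
have cEi i : E i 0 = (i == 0)%:R.
  by have := congr1 (fun v : 'cV_ _ => v i 0) Ee; rewrite -colE !mxE andbT.
have rEi i : E 0 i = (i == 0)%:R.
  have := congr1 (fun v : 'cV_ _ => Num.conj (v i 0)) Ee'.
  by rewrite -colE !mxE conjCK andbT => ->; rewrite rmorph_nat.
have EE : E = block_mx 1%:M 0 0 (drsubmx E).
  rewrite -{1}[E]submxK; congr block_mx; apply/matrixP => i j; rewrite !mxE ?(ord1 i) ?(ord1 j).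
  - by rewrite (_ : lshift _ 0 = 0) ?cEi //; apply/val_inj.
  - by rewrite (_ : lshift _ 0 = 0) ?rEi //; apply/val_inj.
  - by rewrite (_ : lshift _ 0 = 0) ?cEi //; apply/val_inj.
split=> //; move: uE; rewrite /unitary {1 2}EE adjoint_block !adjoint0 adjoint1 mulmx_block.
move=> /(congr1 drsubmx); rewrite block_mxKdr => E1.
by rewrite mulmx0 add0r in E1; rewrite E1 scalar_mx_block block_mxKdr.
Qed.

Let fst_cont (p : R * R) : {for p, continuous fst}. Proof. exact: cvg_fst. Qed.
Let snd_cont (p : R * R) : {for p, continuous snd}. Proof. exact: cvg_snd. Qed.
Let pair_cont (s t : R) : {for t, continuous (fun t : R => (s, t))}.
Proof.
exact: (@cvg_pair _ _ _ (nbhs t) (nbhs s) (nbhs t) _ _ _ (fun=> s) id (cvg_cst s) (@cvg_id _ (nbhs t))).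
Qed.

Let segment_cont n (u v : R * R -> 'cV[C]_n) p : mcont u p -> mcont v p ->
  mcont (fun p : R * R => (1 - p.1)%:C *: u p + p.1%:C *: v p) p.
Proof.
move=> cu cv; apply: mcontD; apply: mcontZ => //; apply: ccont_real => //.
by apply: continuousB => //; exact: cst_continuous.
Qed.

Lemma mcont_col (T : topologicalType) (x : T) p q (F : T -> 'M[C]_(p, q)) j :
  mcont F x -> mcont (fun y => col j (F y)) x.
Proof. by move=> cF i k; under eq_fun do rewrite mxE. Qed.

Lemma mcont_drsubmx (T : topologicalType) (x : T) p1 p2 q1 q2
    (F : T -> 'M[C]_(p1 + p2, q1 + q2)) :
  mcont F x -> mcont (fun y => drsubmx (F y)) x.
Proof. by move=> cF i k; under eq_fun do rewrite !mxE. Qed.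

(* The first column is pushed to a constant: it is first replaced by a nearby
   polygon, which misses a direction for dimension reasons. *)
Lemma loop_split n (P : R -> 'M[C]_n.+2) : unitary_path P -> P 0 = P l ->
  exists (K : 'M[C]_n.+2) (Q : R -> 'M[C]_n.+1),
  [/\ unitary K, unitary_path Q, Q 0 = Q l
    & loop_homotopic P (fun t => K *m block_mx (1%:M : 'M[C]_1) 0 0 (Q t))].
Proof.
move=> uP P0l; pose c t := col 0 (P t).
have e0e0 : dotc (e0 : 'cV[C]_n.+2) e0 = 1.
  rewrite dotcE (bigD1 0) //= big1 => [|i]; first by rewrite !mxE rmorph1 mulr1 addr0.
  by rewrite !mxE andbT => /negPf->; rewrite mulr0.
have cE t : c t = P t *m e0 by rewrite /c colE.
have cc t : 0 <= t <= l -> dotc (c t) (c t) = 1.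
  by move=> /uP[_ uPt]; rewrite cE dotc_unitary.
have cont_c t : 0 <= t <= l -> mcont c t by move=> /uP[cP _]; exact: mcont_col.
(* The mesh is chosen so that the polygon stays in the half-space where the real part of
   [dotc (c t)] is positive; this keeps it away from zero, and the segment from [c t] to it away
   from the ray opposite to [c t]. *)
have [N NP] : exists N : nat, forall y z, 0 <= y <= l -> `|y - z| <= l / N.+1%:R ->
    0 < complex.Re (dotc (c y) (c z)).
  apply: (@lebesgue_number _ _ (fun y z => 0 < complex.Re (dotc (c y) (c z)))) => // x xl.
  have cq : ccont (fun p : R * R => dotc (c p.1) (c p.2)) (x, x).
    by apply: dotc_cont; [apply: (mcont_comp (h := fst))|apply: (mcont_comp (h := snd))] => //;
      exact: cont_c.
  by apply: (cvgr_gt _ cq.1); rewrite /= cc //=; exact: ltr01.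
pose eta := l / N.+1%:R.
pose p := polygon l N c.
(* The real planes spanned by consecutive nodes contain every real multiple of every point of the
   polygon. *)
have [v vP] := avoid_planes (fun j : 'I_N.+1 => c (j%:R * eta)) (fun j => c (j.+1%:R * eta)).
have vp t k : 0 <= t <= l -> v != k%:C *: p t.
  move=> /(polygonE N c l0)[j [s [_ _]]]; rewrite /p => ->.
  by rewrite scalerDr !scalerA -!rmorphM; exact: vP.
have cp t : 0 <= t <= l -> 0 < complex.Re (dotc (c t) (p t)).
  move=> tl; have [j [s [/andP[s0 s1] tE]]] := polygonE N c l0 tl; rewrite /p => ->.
  have eta0 : 0 < eta by rewrite divr_gt0.
  have h1 : 0 < complex.Re (dotc (c t) (c (j%:R * eta))).
    apply: NP => //; rewrite tE -/eta -mulrBl addrAC subrr add0r.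
    by rewrite ger0_norm ?(mulr_ge0 s0 (ltW eta0)) // ler_piMl // ltW.
  have h2 : 0 < complex.Re (dotc (c t) (c (j.+1%:R * eta))).
    apply: NP => //; rewrite tE -/eta -mulrBl -natr1 opprD addrACA subrr add0r.
    by rewrite normrM (gtr0_norm eta0) ler_piMl ?(ltW eta0) // ler_norml; lra.
  rewrite dotcDr !dotcZr raddfD /= !ReM /= !mul0r !subr0.
  have [->|sn0] := eqVneq s 0; first by rewrite subr0 mul1r mul0r addr0.
  have sp : 0 < s by rewrite lt_def sn0.
  by rewrite ltr_wpDl ?(mulr_ge0 _ (ltW h1)) ?subr_ge0 // mulr_gt0.
have p0 t : 0 <= t <= l -> p t != 0.
  by move=> /cp; apply: contraTneq => ->; rewrite /dotc mulmx0 mxE ltxx.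
pose u t := normalize (p t).
have uu t : 0 <= t <= l -> dotc (u t) (u t) = 1.
  by move=> /p0; exact: dotc_normalize.
have cont_p t : mcont p t by exact: polygon_cont.
have cont_u t : 0 <= t <= l -> mcont u t by move=> /p0 ?; exact: mcont_normalize.
pose b (q : R * R) := (1 - q.1)%:C *: c q.2 + q.1%:C *: p q.2.
pose d (q : R * R) := (1 - q.1)%:C *: u q.2 + q.1%:C *: v.
have bP s t : 0 <= s <= 1 -> 0 <= t <= l -> off_ray (c t) (b (s, t)).
  move=> /andP[s0 s1] tl k k0; apply: contraTneq (cp t tl) => /(congr1 (dotc (c t))) /=.
  rewrite dotcDr !dotcZr cc // !mulr1 => /(congr1 (@complex.Re R)) /=.
  rewrite raddfD /= ReM /= mul0r subr0 => h.
  rewrite -leNgt; have [s0'|s0'] := eqVneq s 0; first by move: h; rewrite s0' mul0r; lra.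
  have sp : 0 < s by rewrite lt_def s0'.
  rewrite -(pmulr_rle0 _ sp); lra.
(* For [s > 0], a point of the segment from [u t] to [v] on the ray opposite to [u t] would make [v]
   a real multiple of [p t]. *)
have dP s t : 0 <= s <= 1 -> 0 <= t <= l -> off_ray (u t) (d (s, t)).
  move=> /andP[s0 s1] tl k k0; apply/eqP => /= h.
  have {h} h : s%:C *: v = (- (k + (1 - s)))%:C *: u t.
    by apply/eqP; rewrite opprD rmorphD scalerDl -h addrAC -scalerDl -rmorphD subrr scale0r add0r.
  have [s0'|s0'] := eqVneq s 0.
    move: h; rewrite s0' scale0r subr0 => /(congr1 (dotc (u t))).
    rewrite dotcZr uu // mulr1 /dotc mulmx0 mxE => /(congr1 (@complex.Re R)) /=; lra.
  have := vp t (s^-1 * (- (k + (1 - s))) * (Num.sqrt (sqnorm (p t)))^-1) tl.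
  case/eqP; rewrite !rmorphM /= -!scalerA -/(normalize (p t)) -/(u t) -h scalerA -rmorphM.
  by rewrite mulVf // rmorph1 scale1r.
have p0l : p 0 = p l.
  by rewrite /p polygon0 // polygonl // /c P0l.
(* At [s = 0] both turns are the identity. At [s = 1] the first column goes from [c t] to [u t] and
   then to [normalize v], which does not depend on [t]. *)
pose H (q : R * R) := turn (u q.2) (d q) *m turn (c q.2) (b q) *m P q.2.
have uH s t : 0 <= s <= 1 -> 0 <= t <= l -> unitary (H (s, t)).
  move=> s01 tl; apply: unitaryM; last by case: (uP t tl).
  by apply: unitaryM; apply: turn_unitary; rewrite ?cc ?uu //=; [exact: dP|exact: bP].
have cH s t : 0 <= s <= 1 -> 0 <= t <= l -> mcont H (s, t).
  move=> s01 tl; have [cPt _] := uP t tl.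
  have c2 : mcont (fun q : R * R => c q.2) (s, t).
    by apply: (mcont_comp (h := snd)) => //; exact: cont_c.
  have u2 : mcont (fun q : R * R => u q.2) (s, t).
    by apply: (mcont_comp (h := snd)) => //; exact: cont_u.
  apply: mcontM; last exact: (mcont_comp (h := snd)).
  apply: mcontM; apply: mcont_turn; rewrite ?cc ?uu //=.
  - exact: dP.
  - by apply: segment_cont => //; exact: mcont_cst.
  - exact: bP.
  - by apply: segment_cont => //; exact: (mcont_comp (h := snd)).
pose K := H (1, 0).
have uK : unitary K by exact: uH.
have HH s : H (s, 0) = H (s, l).
  by rewrite /H /b /d /u /= p0l /c P0l.
have H1e t : 0 <= t <= l -> H (1, t) *m e0 = normalize v.
  move=> tl; have -> : H (1, t) *m e0 = turn (u t) (d (1, t)) *m (turn (c t) (b (1, t)) *m c t).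
    by rewrite /H cE /= 2!mulmxA.
  rewrite [X in _ *m X]turn_mul; last 2 first.
  - exact: cc.
  - exact: bP.
  rewrite /b /= subrr scale0r add0r scale1r -/(u t) turn_mul; last 2 first.
  - exact: uu.
  - exact: dP.
  by rewrite /d /= subrr scale0r add0r scale1r.
(* All the [H (1, t)] have the same first column, so dividing by the one at time 0 gives matrices
   that fix [e0], hence blocks. *)
pose E t : 'M[C]_(1 + n.+1) := adjoint K *m H (1, t).
have uE t : 0 <= t <= l -> unitary (E t).
  by move=> tl; apply: unitaryM; [exact: unitaryJ|exact: uH].
have Ee t : 0 <= t <= l -> E t *m e0 = e0.
  move=> tl; rewrite -mulmxA H1e // -(H1e 0) //.
  by rewrite mulmxA uK mul1mx.
exists K, (fun t => drsubmx (E t)); split.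
- exact: uK.
- move=> t tl; have [_ uD] := unitary_fix_e0 (uE t tl) (Ee t tl); split=> //.
  apply: mcont_drsubmx; apply: mcontM; first exact: mcont_cst.
  apply: (@mcont_comp _ _ _ _ _ (fun y : R => (1 : R, y)) H); last exact: cH.
  exact: pair_cont.
- by rewrite /E HH.
- exists H; split; [exact: cH|exact: uH| |by move=> s _; exact: HH].
  move=> t tl; split.
    rewrite /H /b /d /= subr0 !scale1r !scale0r !addr0 !turn1 ?uu ?cc //.
    by rewrite !mul1mx.
  have [<- _] := unitary_fix_e0 (uE t tl) (Ee t tl).
  by rewrite /E mulmxA unitaryC // mul1mx.
Qed.

(** diag (1, ..., 1, x), a multiplicative section of the determinant; the recursion mirrors the
    blocks produced by [loop_split]. *)
Fixpoint last_diag n (x : C) : 'M[C]_n.+1 :=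
  if n is n'.+1 then block_mx (1%:M : 'M[C]_1) 0 0 (last_diag n' x) else x%:M.

Lemma last_diagM n x y : last_diag n x *m last_diag n y = last_diag n (x * y).
Proof.
elim: n => [|n IHn] /=; first by rewrite -scalar_mxM.
by rewrite (@mulmx_block _ 1 n.+1 1 n.+1 1 n.+1) IHn !mulmx0 !mul0mx mulmx1 !addr0 add0r.
Qed.

Lemma last_diag1 n : last_diag n 1 = 1%:M.
Proof. by elim: n => //= n ->; rewrite -scalar_mx_block. Qed.

Lemma det_last_diag n x : \det (last_diag n x) = x.
Proof.
elim: n => [|n IHn] /=; first by rewrite det_scalar1.
by rewrite (@det_ublock _ 1 n.+1) det1 mul1r.
Qed.

Lemma adjoint_last_diag n x : adjoint (last_diag n x) = last_diag n (Num.conj x).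
Proof.
elim: n => [|n IHn] /=.
  by apply/matrixP => i j; rewrite !mxE (ord1 i) (ord1 j) eqxx.
by rewrite (@adjoint_block _ 1 n.+1 1 n.+1) !adjoint0 adjoint1 IHn.
Qed.

Lemma mcont_last_diag n (T : topologicalType) (x : T) (f : T -> C) :
  ccont f x -> mcont (fun y => last_diag n (f y)) x.
Proof.
move=> cf; elim: n => [|n IHn] /=.
  move=> i j; under eq_fun do rewrite mxE (ord1 i) (ord1 j) eqxx mulr1n; exact: cf.
by apply: (@mcont_block _ _ _ 1 n.+1 1 n.+1) => //; exact: mcont_cst.
Qed.

Lemma loop_reduce n (P : R -> 'M[C]_n.+1) : unitary_path P -> P 0 = P l ->
  exists (K : 'M[C]_n.+1) (d : R -> C),
    unitary K /\ loop_homotopic P (fun t => K *m last_diag n (d t)).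
Proof.
elim: n P => [|n IHn] P uP P0l.
  exists 1%:M, (fun t => P t 0 0); split; first exact: unitary1.
  exists (fun p => P p.2); split => //.
  - by move=> s t _ /uP[cP _]; exact: (mcont_comp (h := snd)).
  - by move=> s t _ /uP[].
  - by move=> t _; split=> //=; rewrite mul1mx -mx11_scalar.
have [K [Q [uK uQ Q0l [H [cH uH HP HH]]]]] := loop_split uP P0l.
have [K' [d [uK' [H' [cH' uH' HP' HH']]]]] := IHn Q uQ Q0l.
pose B (X : 'M[C]_n.+1) : 'M[C]_n.+2 := block_mx (1%:M : 'M[C]_1) 0 0 X.
have BM X Y : B X *m B Y = B (X *m Y).
  by rewrite /B (@mulmx_block _ 1 n.+1 1 n.+1 1 n.+1) !mulmx0 !mul0mx mulmx1 !addr0 add0r.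
have uB X : unitary X -> unitary (B X) by exact: unitary_block1.
pose D t := K *m B (Q t).
exists (K *m B K'), d; split; first by apply: unitaryM => //; exact: uB.
(* The two homotopies are multiplied pointwise instead of being run one after the other:
   [adjoint (D p.2)] cancels the second factor at [s = 0] and the first one at [s = 1]. *)
exists (fun p => H p *m adjoint (D p.2) *m K *m B (H' p)); split.
- move=> s t s01 tl; have [cQ _] := uQ t tl.
  apply: mcontM; last first.
    by apply: (@mcont_block _ _ _ 1 n.+1 1 n.+1); try exact: mcont_cst; exact: cH'.
  apply: mcontM; last exact: mcont_cst.
  apply: mcontM; first exact: cH.
  apply: mcontJ; apply: mcontM; first exact: mcont_cst.
  apply: (@mcont_block _ _ _ 1 n.+1 1 n.+1); try exact: mcont_cst.
  exact: (mcont_comp (h := snd)).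
- move=> s t s01 tl; have [_ uQt] := uQ t tl.
  apply: unitaryM; last by apply: uB; exact: uH'.
  apply: unitaryM => //; apply: unitaryM; first exact: uH.
  by apply: unitaryJ; apply: unitaryM => //; exact: uB.
- move=> t tl; have [H0 H1] := HP t tl; have [H0' H1'] := HP' t tl.
  have [_ uQt] := uQ t tl.
  have uD : unitary (D t) by apply: unitaryM => //; exact: uB.
  split; first by rewrite H0 H0' -[_ *m K *m _]mulmxA -/(D t) -mulmxA uD mulmx1.
  rewrite H1 H1' -/(D t) unitaryC // mul1mx -mulmxA; congr (_ *m _).
  by rewrite -BM.
- have D0l : D 0 = D l by rewrite /D Q0l.
  by move=> s s01; rewrite /= (HH s s01) (HH' s s01) D0l.
Qed.

(** The pointwise quotient of the two paths is a loop at the identity. Once reduced, it varies only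
    in its last diagonal entry, and the hypothesis on [phi] and [psi] says that its determinant has
    no winding. *)
Theorem path_homotopy n (A B : R -> 'M[C]_n) (phi psi : R -> R) :
  unitary_path A -> unitary_path B -> A 0 = B 0 -> A l = B l ->
  (forall t, 0 <= t <= l -> {for t, continuous phi} /\ {for t, continuous psi}) ->
  (forall t, 0 <= t <= l -> \det (A t) = expi (phi t) /\ \det (B t) = expi (psi t)) ->
  phi 0 - psi 0 = phi l - psi l ->
  exists H : R * R -> 'M[C]_n,
  [/\ forall s t, 0 <= s <= 1 -> 0 <= t <= l -> mcont H (s, t),
      forall s t, 0 <= s <= 1 -> 0 <= t <= l -> unitary (H (s, t)),
      forall t, 0 <= t <= l -> H (0, t) = A t /\ H (1, t) = B t
    & forall s, 0 <= s <= 1 -> H (s, 0) = A 0 /\ H (s, l) = A l].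
Proof.
move=> uA uB AB0 ABl cphi dA phipsi; case: n => [|n] in A B uA uB AB0 ABl dA *.
  exists (fun p => A p.2); split => //.
  - by move=> s t _ /uA[cA _]; exact: (mcont_comp (h := snd)).
  - by move=> s t _ /uA[].
  - by move=> t _; split=> //; apply/matrixP => -[].
pose P t := A t *m adjoint (B t).
have uP : unitary_path P.
  move=> t tl; have [cA uAt] := uA t tl; have [cB uBt] := uB t tl; split.
    by apply: mcontM => //; exact: mcontJ.
  by apply: unitaryM => //; exact: unitaryJ.
have P0 : P 0 = 1%:M by rewrite /P AB0 unitaryC //; case: (uB 0 zl).
have Pl : P l = 1%:M by rewrite /P ABl unitaryC //; case: (uB l ll).
have detP t : 0 <= t <= l -> \det (P t) = expi (phi t - psi t).
  by move=> /dA[dAt dBt]; rewrite det_mulmx det_adjoint dAt dBt conj_expi -expiD.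
have [|K [d [uK [H [cH uH HP HH]]]]] := loop_reduce uP; first by rewrite P0 Pl.
(* The correction gives [G] the determinant [expi ((1 - s) * (phi t - psi t))]. It is trivial at
   [s = 0]; at [s = 1] the determinant is 1, which forces the last entry, and so [G], to be constant
   in [t]. *)
pose x (p : R * R) : C := Num.conj (\det (H p)) * expi ((1 - p.1) * (phi p.2 - psi p.2)).
pose G p := H p *m last_diag n (x p).
have uG s t : 0 <= s <= 1 -> 0 <= t <= l -> unitary (G (s, t)).
  move=> s01 tl; apply: unitaryM; first exact: uH.
  rewrite /unitary adjoint_last_diag last_diagM /x rmorphM /= conj_expi conjCK.
  rewrite mulrACA -expiD addNr expi0 mulr1 mulrC (det_unitary (uH s t s01 tl)).
  exact: last_diag1.
have cG s t : 0 <= s <= 1 -> 0 <= t <= l -> mcont G (s, t).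
  move=> s01 tl; apply: mcontM; first exact: cH.
  apply: mcont_last_diag; apply: ccontM.
    by apply: ccontJ; apply: ccont_det; exact: cH.
  have [c1 c2] := cphi t tl.
  apply: ccont_expi; apply: continuousM.
    by apply: continuousB; [exact: cst_continuous|exact: fst_cont].
  by apply: continuousB; apply: (continuous_comp (f := snd)).
have G0 t : 0 <= t <= l -> G (0, t) = P t.
  move=> tl; have [H0 _] := HP t tl.
  rewrite /G /x H0 detP // conj_expi /= subr0 mul1r -expiD addNr expi0 last_diag1.
  by rewrite mulmx1.
have G1 t : 0 <= t <= l -> G (1, t) = K *m last_diag n (Num.conj (\det K)).
  move=> tl; have [_ H1] := HP t tl.
  have := det_unitary (uH 1 t o1 tl); rewrite H1 det_mulmx det_last_diag => dd.
  have := det_unitary uK => dK.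
  rewrite /G /x H1 /= subrr mul0r expi0 mulr1 det_mulmx det_last_diag -mulmxA last_diagM.
  congr (_ *m last_diag _ _); rewrite rmorphM /=.
  transitivity (Num.conj (\det K) * (Num.conj (d t) * d t)); first by ring.
  suff -> : Num.conj (d t) * d t = 1 by rewrite mulr1.
  by rewrite -dd rmorphM /= mulrACA dK mul1r.
have GG s : 0 <= s <= 1 -> G (s, l) = G (s, 0).
  by move=> s01; rewrite /G /x /= HH // phipsi.
(* Dividing by [G (s, 0)] puts the moving base point back at the identity, and multiplying by [B]
   undoes the quotient. *)
exists (fun p => G p *m adjoint (G (p.1, 0)) *m B p.2); split.
- move=> s t s01 tl; have [cB _] := uB t tl.
  apply: mcontM; last exact: (mcont_comp (h := snd)).
  apply: mcontM; first exact: cG.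
  apply: mcontJ; apply: (mcont_comp (h := fun p : R * R => (p.1, 0))); last exact: cG.
  exact: (@cvg_pair _ _ _ (nbhs (s, t)) (nbhs s) (nbhs (0 : R)) _ _ _ fst (fun=> 0)
    (@fst_cont (s, t)) (cvg_cst _)).
- move=> s t s01 tl; have [_ uBt] := uB t tl.
  apply: unitaryM => //; apply: unitaryM; first exact: uG.
  by apply: unitaryJ; exact: uG.
- move=> t tl; have [_ uBt] := uB t tl; split => /=.
    rewrite !G0 // P0 adjoint1 mulmx1 /P -mulmxA uBt mulmx1 //.
  by rewrite !G1 // unitaryC ?mul1mx // -(G1 t tl); exact: uG.
- move=> s s01 /=; rewrite GG // unitaryC ?mul1mx //; exact: uG.
Qed.

End Loops.

(** * The index of a diagonal path *)

Section Profile.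
Variable R : realType.
Implicit Types a b t : R.

(** [Q s] is the sum of the floor and the ceiling of [s], which negation exchanges up to sign. *)
Lemma QN a : Q (- a) = - Q a.
Proof.
rewrite /Q rpredN; case: ifPn => ai; first by rewrite mulrN.
rewrite -[Num.floor (- a)]opprK -ceilNfloor ceil_floor ai rmorphN rmorphD /=; lra.
Qed.

Lemma QD_int a k : k \is a Num.int -> Q (a + k) = Q a + 2 * k.
Proof.
move=> ki; rewrite /Q rpredDr //; case: ifP => ai; first by rewrite mulrDr.
have [z kE] := intrP ki; rewrite floorDrz // rmorphD /= (_ : (Num.floor k)%:~R = k).
  by rewrite mulrDr; ring.
by apply/eqP; rewrite -intrEfloor.
Qed.

Definition crossing_sign (f df : R -> R) t : R :=
  if f t \is a Num.int then Num.sg (df t) else 0.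

(** For [b > 0], the number of integers in ]0, b[; an integral [b] is itself an endpoint, hence the
    predecessor. *)
Definition inner_crossings b : nat :=
  if b \is a Num.int then (Num.truncn b).-1 else Num.truncn b.

Lemma inner_crossingsP b (k : nat) : 0 < b ->
  (k.+1%:R < b) = (k < inner_crossings b)%N.
Proof.
move=> b0; have /andP[nb bn] := truncn_itv (ltW b0); rewrite /inner_crossings.
case: ifPn => [|bi].
  rewrite intrEge0 ?(ltW b0) // natrEtruncn => /eqP bE.
  by rewrite -{1}bE ltr_nat -ltnS; case: (Num.truncn b) => // n; rewrite ltn0 !ltnS.
apply/idP/idP => [kb|kn]; first by rewrite truncn_ge_nat ?(ltW b0) ?ltW.
rewrite lt_neqAle (le_trans _ nb) ?ler_nat // andbT.
by apply: contraNneq bi => <-; rewrite intr_nat.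
Qed.

(** The origin of [Q]: a crossing of one complex eigenvalue has signature 2 up to sign, and the
    endpoints have weight one half. The start thus counts 1, each inner integer 2, and the end 1 if
    [b] is an integer. *)
Lemma Q_count b : 0 < b ->
  Q b = 1 + 2 * (inner_crossings b)%:R + (b \is a Num.int)%:R.
Proof.
move=> b0; rewrite /Q /inner_crossings; case: ifPn => bi /=.
  move: (bi); rewrite intrEge0 ?(ltW b0) // natrEtruncn => /eqP bE.
  have : (0 < Num.truncn b)%N by rewrite -(ltr_nat R) bE.
  by move: (Num.truncn b) bE => [//|n] <- _; rewrite -natr1 /=; lra.
by rewrite truncn_floor (ltW b0) natr_absz ger0_norm ?floor_ge0 ?(ltW b0) // addr0 addrC.
Qed.

(* For a = 0 the linear phase is constant and all its crossings are degenerate: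
   it is replaced by a bump. *)
Lemma exists_profile (l a : R) : 0 < l -> exists (f df : R -> R) (r : seq R),
  [/\ (forall t, is_derive t 1 f (df t)) /\ continuous df,
      f 0 = 0 /\ f l = a,
      forall t, 0 <= t <= l -> f t \is a Num.int -> df t != 0,
      {subset r <= `]0, l[} /\ forall t, 0 < t < l -> t \notin r -> f t \isn't a Num.int
    & crossing_sign f df 0 + \sum_(t \in [set` `]0, l[]) 2 * crossing_sign f df t
      + crossing_sign f df l = Q a].
Proof.
move=> l0; have l_neq0 : l != 0 by rewrite gt_eqF.
have l2E : l - 2 * l = - l by ring.
have [->|a0] := eqVneq a 0.
  (* The bump lies strictly between 0 and 1 inside the interval. Its slopes at the two ends are
     opposite, so the two end crossings cancel, as [Q 0 = 0] demands. *)
  pose f t := 4^-1 * (t * (l - t) / (l * l)).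
  pose df t := 4^-1 * ((l - 2 * t) / (l * l)).
  have fE : f = (4^-1 / l) \*: id - (4^-1 / (l * l)) \*: (id ^+ 2).
    apply/funext => t; transitivity (4^-1 / l * t - 4^-1 / (l * l) * t ^+ 2); last by [].
    by rewrite /f; field; rewrite gt_eqF.
  have f_nint t : 0 < t < l -> f t \isn't a Num.int.
    move=> /andP[t0 tl].
    have f0 : 0 < f t by rewrite mulr_gt0 // divr_gt0 ?mulr_gt0 // subr_gt0.
    have f1 : f t < 1.
      have : t * (l - t) / (l * l) < 1 by rewrite ltr_pdivrMr ?mulr_gt0 // mul1r; nra.
      by rewrite /f; lra.
    apply/negP => /intrP[z fz].
    by move: f0 f1; rewrite fz ltr0z ltrz1 gtz0_ge1 leNgt => /negPf->.
  exists f, df, [::]; split.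
  - split => t.
      rewrite fE /df; apply: is_derive_eq; rewrite /=.
      transitivity (4^-1 / l * 1 - 4^-1 / (l * l) * (2 * t * 1)).
        by [].
      by field; rewrite gt_eqF.
    apply: (@continuousM _ _ (fun=> 4^-1) (fun t => (l - 2 * t) / (l * l))).
      exact: cst_continuous.
    apply: (@continuousM _ _ (fun t => l - 2 * t)); last exact: cst_continuous.
    apply: (@continuousB _ _ _ (fun=> l)); first exact: cst_continuous.
    by apply: (@continuousM _ _ (fun=> 2) id); [exact: cst_continuous|exact: cvg_id].
  - by rewrite /f !mul0r !subrr !mulr0 !mul0r mulr0.
  - move=> t tl fi; rewrite /df.
    have [->|t0] := eqVneq t 0.
      by rewrite mulr0 subr0 !(mulf_neq0, invr_neq0) // pnatr_eq0.
    have [->|tl'] := eqVneq t l.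
      by rewrite l2E !(mulf_neq0, invr_neq0, oppr_eq0) // pnatr_eq0.
    have : 0 < t < l by lra.
    by move=> /f_nint; rewrite fi.
  - by split=> // t tl _; exact: f_nint.
  - rewrite fsbig1; last by move=> t /= /itvP tl; rewrite /crossing_sign (negPf (f_nint t _)) ?mulr0 // !tl.
    rewrite /crossing_sign /df /f !mul0r !subrr !mulr0 !mul0r !mulr0 rpred0 subr0.
    rewrite l2E.
    rewrite mulNr mulrN sgrN addr0 subrr /Q rpred0 mulr0 //.
pose b := `|a|; have b0 : 0 < b by rewrite normr_gt0.
have ab : a = Num.sg a * b by rewrite /b -numEsg.
have sg1 : Num.sg a = 1 \/ Num.sg a = -1.
  by move: a0; rewrite neq_lt => /orP[/ltr0_sg|/gtr0_sg]; [right|left].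
(* The linear phase meets the integers inside the interval at the multiples of [l / b], always with
   the sign of [a]. *)
pose f t := a / l * t; pose K := inner_crossings b.
pose r := [seq k.+1%:R * (l / b) | k <- iota 0 K].
have b_neq0 : b != 0 by rewrite gt_eqF.
have f_int t : (f t \is a Num.int) = (b / l * t \is a Num.int).
  by rewrite /f ab; case: sg1 => ->; rewrite ?mul1r ?mulN1r ?mulNr ?rpredN.
have rP t : 0 < t < l -> (f t \is a Num.int) = (t \in r).
  move=> /andP[t0 tl]; rewrite f_int; apply/idP/mapP.
    have bt0 : 0 < b / l * t by rewrite mulr_gt0 // divr_gt0.
    rewrite intrEge0 ?ltW // => /natrP[[|k] kE]; first by rewrite kE ltxx in bt0.
    exists k; last by rewrite -kE; field; rewrite b_neq0.
    rewrite mem_iota /= add0n -inner_crossingsP // -kE mulrAC ltr_pdivrMr //.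
    by rewrite ltr_pM2l.
  move=> [k _ ->]; rewrite (_ : _ * _ = k.+1%:R) ?intr_nat //.
  by field; rewrite ?b_neq0 ?l_neq0.
have r_sub t : t \in r -> 0 < t < l.
  move=> /mapP[k]; rewrite mem_iota /= add0n => kK ->.
  rewrite mulr_gt0 ?divr_gt0 //= mulrA ltr_pdivrMr // [l * b]mulrC ltr_pM2r //.
  by rewrite inner_crossingsP.
have r_uniq : uniq r.
  rewrite map_inj_uniq ?iota_uniq // => i j /(mulIf _) ij.
  have /eqP := ij (mulf_neq0 l_neq0 (invr_neq0 b_neq0)).
  by rewrite eqr_nat => /eqP[].
exists f, (fun=> a / l), r; split.
- split=> t; last exact: cst_continuous.
  rewrite (_ : f = (a / l) \*: id); last by apply/funext.
  by apply: is_derive_eq; exact: mulr1.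
- by rewrite /f mulr0 divfK.
- by move=> t _ _; rewrite mulf_neq0 // invr_eq0.
- split=> [t /r_sub|t tl]; first by rewrite in_itv.
  by rewrite rP.
- have sgE : Num.sg (a / l) = Num.sg a by rewrite sgrM [Num.sg l^-1]gtr0_sg ?invr_gt0 // mulr1.
  have c_int t : f t \is a Num.int -> crossing_sign f (fun=> a / l) t = Num.sg a.
    by rewrite /crossing_sign sgE => ->.
  rewrite (fsbigE r) //; last first.
    move=> t /=; rewrite in_itv /= => tl; rewrite -rP // => /negPf tr.
    by rewrite /crossing_sign tr mulr0.
  rewrite big_mkcond /= (eq_big_seq (fun=> 2 * Num.sg a)); last first.
    move=> t tr; have tl := r_sub t tr; rewrite c_int ?rP // ifT //.
    by rewrite inE /= in_itv.
  rewrite big_const_seq count_predT size_map size_iota iter_addr_0.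
  rewrite c_int ?/f ?mulr0 ?rpred0 // -/f.
  have Qab : Q a = Num.sg a * Q b.
    by rewrite {1}ab; case: sg1 => ->; rewrite ?mul1r // !mulN1r QN.
  rewrite Qab Q_count // /crossing_sign f_int divfK // sgE -/K -[_ *+ K]mulr_natr.
  by case: (b \is a Num.int) => /=; ring.
Qed.

End Profile.

(** * Signature of a diagonal quadratic form *)

Section DiagonalForm.
Variables (R : realType) (N : nat) (X : 'M[R]_N) (S : {set 'I_N}) (K : set 'cV[R]_N).
Hypothesis X_unit : X \in unitmx.
Hypothesis KP : forall v, K v <-> forall a, a \notin S -> (X *m v) a 0 = 0.

(** Sylvester's law of inertia: a subspace of dimension larger than [#|T|] contains a nonzero vector
    whose coordinates in [T] vanish, and there the form is at most 0; the coordinate subspace of [T]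
    itself is positive. *)
Lemma pos_index_diag (kappa : 'I_N -> R) q :
  (forall v, K v -> q v = \sum_(a in S) kappa a * (X *m v) a 0 ^+ 2) ->
  pos_index K q = #|[set a in S | 0 < kappa a]|.
Proof.
move=> qE; set T := [set a in S | _]; apply/eqP; rewrite eqn_leq; apply/andP; split.
  apply/bigmax_leqP => -[k /= kN] /asboolP[B BP]; rewrite leqNgt; apply/negP => Tk.
  pose Y : 'M[R]_(#|T|, k) := rowsub (@enum_val _ (mem T)) (X *m B).
  have : kermx Y^T != 0.
    rewrite -mxrank_eq0 mxrank_ker subn_eq0 -ltnNge.
    exact: leq_ltn_trans (rank_leq_col _) Tk.
  rewrite -nz_row_eq0 => c0; set c := nz_row _ in c0.
  have cY : Y *m c^T = 0.
    apply: trmx_inj; rewrite trmx_mul trmxK trmx0; apply/sub_kermxP; exact: nz_row_sub.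
  have [|KB] := BP c^T; first by rewrite -(inj_eq (@trmx_inj _ _ _)) trmxK trmx0.
  rewrite qE // ltNge => /negP; apply; apply: sumr_le0 => a aS.
  have [ka|ka] := leP (kappa a) 0; first by rewrite mulr_le0_ge0 // sqr_ge0.
  have aT : a \in T by rewrite inE aS.
  have := congr1 (fun v : 'cV_ _ => v (enum_rank_in aT a) 0) cY.
  rewrite /Y mul_rowsub_mx [LHS]mxE [RHS]mxE enum_rankK_in // -mulmxA => ->.
  by rewrite expr0n mulr0.
have TN : (#|T| < N.+1)%N by rewrite ltnS (leq_trans (max_card _)) // card_ord.
rewrite -[#|T|]/(val (Ordinal TN)); apply: leq_bigmax_cond; apply/asboolP => /=.
pose B0 : 'M[R]_(N, #|T|) := \matrix_(a, i) (a == enum_val i)%:R.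
have B0E (c : 'cV_#|T|) i : (B0 *m c) (enum_val i) 0 = c i 0.
  rewrite mxE (bigD1 i) //= big1 => [|j ji]; first by rewrite mxE eqxx mul1r addr0.
  by rewrite mxE (inj_eq enum_val_inj) eq_sym (negPf ji) mul0r.
have B0_out (c : 'cV_#|T|) a : a \notin T -> (B0 *m c) a 0 = 0.
  move=> aT; rewrite mxE big1 // => i _; rewrite mxE.
  by case: eqVneq aT => [->|]; rewrite ?enum_valP // mul0r.
exists (invmx X *m B0) => c c0.
have XB : X *m (invmx X *m B0 *m c) = B0 *m c by rewrite !mulmxA mulmxV // mul1mx.
have Kc : K (invmx X *m B0 *m c).
  by apply/KP => a aS; rewrite XB B0_out // inE (negPf aS).
split=> //; rewrite qE // XB.
have [i ci] : exists i, c i 0 != 0.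
  apply/existsP; apply: contraNT c0 => /existsPn c0; apply/eqP/matrixP => i j.
  by rewrite (ord1 j) mxE; apply/eqP/negPn.
have : enum_val i \in T by exact: enum_valP.
rewrite inE => /andP[iS ki]; rewrite (bigD1 (enum_val i)) //= ltr_pwDl //.
  by rewrite mulr_gt0 // B0E lt_def sqr_ge0 sqrf_eq0 ci.
apply: sumr_ge0 => a /andP[aS _]; have [aT|aT] := boolP (a \in T).
  by move: aT; rewrite inE => /andP[_ ka]; rewrite mulr_ge0 ?sqr_ge0 // ltW.
by rewrite B0_out // expr0n mulr0.
Qed.

Lemma signature_diag (kappa : 'I_N -> R) q :
  (forall v, K v -> q v = \sum_(a in S) kappa a * (X *m v) a 0 ^+ 2) ->
  signature K q = \sum_(a in S) Num.sg (kappa a).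
Proof.
move=> qE; rewrite /signature (pos_index_diag qE).
rewrite (pos_index_diag (kappa := fun a => - kappa a)); last first.
  by move=> v Kv; rewrite qE // -sumrN; apply: eq_bigr => a _; rewrite mulNr.
have cardE (P : pred 'I_N) : #|[set a in S | P a]|%:R = \sum_(a in S) (P a)%:R :> R.
  rewrite -sum1_card natr_sum big_mkcond [RHS]big_mkcond /=; apply: eq_bigr => a _.
  by rewrite inE; case: (a \in S); case: (P a).
rewrite !cardE -sumrB; apply: eq_bigr => a _; rewrite oppr_gt0.
by case: sgrP; rewrite ?subr0 ?subrr ?sub0r.
Qed.

End DiagonalForm.

(** * Complex matrices acting on a real symplectic space *)

Section Realify.
Variables (R : realType) (m : nat).
Local Notation C := R[i].
Implicit Types (A B : 'M[C]_m) (v w : 'cV[R]_(m + m)).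

Lemma map_Re_mul (p q r : nat) (A : 'M[C]_(p, q)) (B : 'M[C]_(q, r)) :
  map_mx (@complex.Re R) (A *m B) =
    map_mx (@complex.Re R) A *m map_mx (@complex.Re R) B
    - map_mx (@complex.Im R) A *m map_mx (@complex.Im R) B.
Proof.
apply/matrixP => i j; rewrite !mxE raddf_sum -sumrB; apply: eq_bigr => k _.
by rewrite !mxE /= ReM.
Qed.

Lemma map_Im_mul (p q r : nat) (A : 'M[C]_(p, q)) (B : 'M[C]_(q, r)) :
  map_mx (@complex.Im R) (A *m B) =
    map_mx (@complex.Re R) A *m map_mx (@complex.Im R) B
    + map_mx (@complex.Im R) A *m map_mx (@complex.Re R) B.
Proof.
apply/matrixP => i j; rewrite !mxE raddf_sum -big_split; apply: eq_bigr => k _.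
by rewrite !mxE /= ImM.
Qed.

Lemma realifyM A B : realify (A *m B) = realify A *m realify B.
Proof.
rewrite /realify mulmx_block map_Re_mul map_Im_mul.
rewrite !mulmxN !mulNmx opprD; congr block_mx; first by rewrite addrC.
by rewrite addrC.
Qed.

Lemma realify1 : realify (1%:M : 'M[C]_m) = 1%:M.
Proof.
rewrite [RHS]scalar_mx_block /realify.
have -> : map_mx (@complex.Re R) (1%:M : 'M[C]_m) = 1%:M.
  by apply/matrixP => i j; rewrite !mxE; case: eqP.
have -> : map_mx (@complex.Im R) (1%:M : 'M[C]_m) = 0.
  by apply/matrixP => i j; rewrite !mxE; case: eqP.
by rewrite oppr0.
Qed.

Lemma realify_adjoint A : realify (adjoint A) = (realify A)^T.
Proof.
rewrite /realify tr_block_mx; congr block_mx; apply/matrixP => i j; rewrite !mxE;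
  by case: (A j i) => a b /=; rewrite ?opprK.
Qed.

Lemma realify_i : realify ('i%:M : 'M[C]_m) = J0 R m.
Proof.
rewrite /realify /J0.
have -> : map_mx (@complex.Re R) ('i%:M : 'M[C]_m) = 0.
  by apply/matrixP => i j; rewrite !mxE; case: eqP.
have -> // : map_mx (@complex.Im R) ('i%:M : 'M[C]_m) = 1%:M.
by apply/matrixP => i j; rewrite !mxE; case: eqP.
Qed.

(** Transposition corresponds to [adjoint] and [J0] to the scalar [i], which commutes with [A]; what
    remains is unitarity. *)
Lemma symplectic_realify A : unitary A -> symplectic (realify A).
Proof.
move=> uA; rewrite /symplectic -realify_adjoint -realify_i -!realifyM.
by rewrite mul_mx_scalar -scalemxAl uA scalemx1.
Qed.

Definition cplx v : 'cV[C]_m := \col_j (v (lshift m j) 0 +i* v (rshift m j) 0).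

Lemma cplx_inj : injective cplx.
Proof.
move=> v w E; apply/matrixP => a b; rewrite (ord1 b).
by case: (split_ordP a) => j ->; have := congr1 (fun x : 'cV_ _ => x j 0) E; rewrite !mxE => -[].
Qed.

Lemma cplxK (x : 'cV[C]_m) :
  cplx (col_mx (map_mx (@complex.Re R) x) (map_mx (@complex.Im R) x)) = x.
Proof.
apply/matrixP => i j; rewrite (ord1 j) mxE col_mxEu col_mxEd !mxE.
by case: (x i 0).
Qed.

Lemma cplx_mul A v : cplx (realify A *m v) = A *m cplx v.
Proof.
have [x ->] : exists x : 'cV[C]_m, v = col_mx (map_mx (@complex.Re R) x) (map_mx (@complex.Im R) x).
  by exists (cplx v); apply: cplx_inj; rewrite cplxK.
rewrite cplxK -[RHS]cplxK; congr cplx.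
by rewrite mul_block_col map_Re_mul map_Im_mul mulNmx [X in col_mx _ X]addrC.
Qed.

(** This fixes the sign of the index: with [dotc] conjugate-linear on the left, a phase that
    increases has a positive crossing form. *)
Lemma omega0E v w : omega0 v w = complex.Im (dotc (cplx v) (cplx w)).
Proof.
rewrite -[v]vsubmxK -[w]vsubmxK; move: (usubmx v) (dsubmx v) (usubmx w) (dsubmx w) => a b c d.
rewrite /omega0 /J0 mul_block_col !mul0mx mulNmx !mul1mx add0r addr0 tr_col_mx mul_row_col.
rewrite dotcE raddf_sum mxE [X in X + _]mxE [X in _ + X]mxE -big_split /=.
apply: eq_bigr => j _; rewrite ![cplx _ _ _]mxE !col_mxEu !col_mxEd !mxE /=; ring.
Qed.

End Realify.

(** * Derivatives of complex-valued paths *)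

Section ComplexDerivative.
Variable R : realType.
Local Notation C := R[i].

Definition cderive (f : R -> C) (t : R) (df : C) : Prop :=
  is_derive t 1 (fun s => complex.Re (f s)) (complex.Re df) /\
  is_derive t 1 (fun s => complex.Im (f s)) (complex.Im df).

Lemma cderive_expi (f : R -> R) (t d : R) : is_derive t 1 f d ->
  cderive (fun s => expi (f s)) t ((0 +i* (2 * pi * d)) * expi (f t)).
Proof.
move=> fd.
have gd : is_derive t 1 (fun s => 2 * pi * f s) (2 * pi * d).
  have -> : (fun s => 2 * pi * f s) = (2 * pi) \*: f by apply/funext.
  exact: is_deriveZ.
split => /=.
  have := @is_derive1_comp _ cos (fun s => 2 * pi * f s) t _ _ (is_derive_cos _) gd.
  by move=> h; apply: (is_derive_eq h); ring.
have := @is_derive1_comp _ sin (fun s => 2 * pi * f s) t _ _ (is_derive_sin _) gd.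
by move=> h; apply: (is_derive_eq h); ring.
Qed.

Lemma cderiveMl (c : C) (f : R -> C) (t : R) (d : C) :
  cderive f t d -> cderive (fun s => c * f s) t (c * d).
Proof.
move=> [fR fI]; split.
  have -> : (fun s => complex.Re (c * f s)) =
      complex.Re c \*: (fun s => complex.Re (f s)) - complex.Im c \*: (fun s => complex.Im (f s)).
    by apply/funext => s; rewrite ReM.
  by rewrite ReM; exact: is_deriveB.
have -> : (fun s => complex.Im (c * f s)) =
    complex.Re c \*: (fun s => complex.Im (f s)) + complex.Im c \*: (fun s => complex.Re (f s)).
  by apply/funext => s; rewrite ImM.
by rewrite ImM; exact: is_deriveD.
Qed.

Lemma cderive_sum n (f : 'I_n -> R -> C) (t : R) (d : 'I_n -> C) :
  (forall k, cderive (f k) t (d k)) ->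
  cderive (fun s => \sum_k f k s) t (\sum_k d k).
Proof.
move=> fd; split.
  have -> : (fun s => complex.Re (\sum_k f k s)) = \sum_k (fun s => complex.Re (f k s)).
    by apply/funext => s; rewrite fct_sumE raddf_sum.
  by rewrite raddf_sum; apply: is_derive_sum => k; case: (fd k).
have -> : (fun s => complex.Im (\sum_k f k s)) = \sum_k (fun s => complex.Im (f k s)).
  by apply/funext => s; rewrite fct_sumE raddf_sum.
by rewrite raddf_sum; apply: is_derive_sum => k; case: (fd k).
Qed.

Lemma realify_derive m (G dG : R -> 'M[C]_m) (t : R) i j :
  (forall i j, cderive (fun s => G s i j) t (dG t i j)) ->
  is_derive t 1 (fun s => realify (G s) i j) (realify (dG t) i j).
Proof.
move=> Gd; case: (split_ordP i) => i' ->; case: (split_ordP j) => j' ->; have [dR dI] := Gd i' j'.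
- rewrite /realify block_mxEul mxE.
  by under eq_fun do rewrite block_mxEul mxE.
- rewrite /realify block_mxEur 2!mxE.
  under eq_fun do rewrite block_mxEur 2!mxE.
  exact: is_deriveN.
- rewrite /realify block_mxEdl mxE.
  by under eq_fun do rewrite block_mxEdl mxE.
- rewrite /realify block_mxEdr mxE.
  by under eq_fun do rewrite block_mxEdr mxE.
Qed.

Lemma realify_cont (T : topologicalType) (x : T) m (G : T -> 'M[C]_m) i j :
  mcont G x -> {for x, continuous (fun y => realify (G y) i j)}.
Proof.
move=> cG; case: (split_ordP i) => i' ->; case: (split_ordP j) => j' ->; have [cR cI] := cG i' j'.
- by apply: cont_ext cR => y; rewrite block_mxEul mxE.
- apply: (@cont_ext _ _ _ (fun y => - complex.Im (G y i' j'))) => [y|].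
    by rewrite block_mxEur 2!mxE.
  exact: continuousN.
- by apply: cont_ext cI => y; rewrite block_mxEdl mxE.
- by apply: cont_ext cR => y; rewrite block_mxEdr mxE.
Qed.

End ComplexDerivative.

Lemma Re_conjM (R : realType) (k : R) (z : R[i]) :
  complex.Re (Num.conj (k%:C * z) * z) = k * (complex.Re z ^+ 2 + complex.Im z ^+ 2).
Proof.
rewrite -[Num.conj _]/(conjc _); case: z => a b /=; ring.
Qed.

(** * Crossings of a unitarily diagonalized path *)

Section DiagonalPath.
Variables (R : realType) (m : nat) (P : 'M[R[i]]_m) (f df : 'I_m -> R -> R).
Hypothesis uP : unitary P.
Hypothesis fd : forall j (t : R), is_derive t 1 (f j) (df j t).
Hypothesis dfc : forall j, continuous (df j).
Local Notation C := R[i].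

Definition diag_path (t : R) : 'M[C]_m :=
  P *m diag_mx (\row_j expi (f j t)) *m adjoint P.

Let ddiag (t : R) : 'rV[C]_m := \row_j ((0 +i* (2 * pi * df j t)) * expi (f j t)).
Let dpath (t : R) : 'M[C]_m := P *m diag_mx (ddiag t) *m adjoint P.
Let Phi t := realify (diag_path t).

Let fc j : continuous (f j).
Proof.
move=> t; apply: differentiable_continuous; apply/derivable1_diffP.
by have [] := fd j t.
Qed.

Let conj_diagE (d : 'rV[C]_m) i j :
  (P *m diag_mx d *m adjoint P) i j = \sum_k (P i k * Num.conj (P j k)) * d 0 k.
Proof.
rewrite mul_mx_diag mxE; apply: eq_bigr => k _.
by rewrite !mxE mulrAC.
Qed.

Lemma diag_path_unitary t : unitary (diag_path t).
Proof.
apply: unitaryM; last exact: unitaryJ.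
by apply: unitaryM => //; exact: unitary_diag_expi.
Qed.

Lemma diag_path_cont t : mcont diag_path t.
Proof.
apply: mcontM; last exact: mcont_cst.
apply: mcontM; first exact: mcont_cst.
apply: mcont_diag => i j; under eq_fun do rewrite mxE.
by apply: ccont_expi; exact: fc.
Qed.

Let dpath_cont t : mcont dpath t.
Proof.
apply: mcontM; last exact: mcont_cst.
apply: mcontM; first exact: mcont_cst.
apply: mcont_diag => i j; under eq_fun do rewrite mxE.
apply: ccontM; last by apply: ccont_expi; exact: fc.
split=> /=; first exact: cst_continuous.
by apply: continuousM; [exact: cst_continuous|exact: dfc].
Qed.

Let Phi_derive (t : R) i j : is_derive t 1 (fun s => Phi s i j) (realify (dpath t) i j).
Proof.
apply: realify_derive => {}i {}j; rewrite conj_diagE.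
under eq_fun do rewrite conj_diagE.
apply: cderive_sum => k; rewrite mxE; under eq_fun do rewrite mxE.
by apply: cderiveMl; exact: cderive_expi.
Qed.

Let derive1_Phi i j : derive1 (fun s => Phi s i j) = (fun t => realify (dpath t) i j).
Proof. by apply/funext => t; rewrite derive1E; have [_ ->] := Phi_derive t i j. Qed.

Lemma diag_path_C1 : C1_path Phi.
Proof.
move=> i j; split=> [t|]; first by have [] := Phi_derive t i j.
by rewrite derive1_Phi => t; apply: realify_cont; exact: dpath_cont.
Qed.

Let path_derivativeE t : path_derivative Phi t = realify (dpath t).
Proof. by apply/matrixP => i j; rewrite mxE derive1_Phi. Qed.

Let coord (v : 'cV[R]_(m + m)) : 'cV[C]_m := adjoint P *m cplx v.

Let cplxE v : cplx v = P *m coord v.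
Proof. by rewrite /coord mulmxA unitaryC // mul1mx. Qed.

Let coord_path d v : adjoint P *m (P *m diag_mx d *m adjoint P *m cplx v) = diag_mx d *m coord v.
Proof. by rewrite !mulmxA uP mul1mx. Qed.

Let crossingP t v :
  crossing_space Phi t v <-> forall j, f j t \isn't a Num.int -> coord v j 0 = 0.
Proof.
have E : crossing_space Phi t v <-> diag_mx (\row_j expi (f j t)) *m coord v = coord v.
  rewrite /crossing_space /= /Phi; split => [h|h].
    by rewrite -coord_path -[X in _ *m X]/(diag_path t *m cplx v) -cplx_mul h.
  apply: cplx_inj; rewrite cplx_mul [RHS]cplxE -h -coord_path mulmxA unitaryC // mul1mx.
  by [].
have diagE j : (diag_mx (\row_j expi (f j t)) *m coord v) j 0 = expi (f j t) * coord v j 0.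
  by rewrite mul_diag_mx mxE [X in X * _]mxE.
rewrite E; split=> [h j fj|h].
  have /eqP := diagE j; rewrite h -subr_eq0 -{1}[coord v j 0]mul1r -mulrBl mulf_eq0.
  by rewrite subr_eq0 eq_sym expi_eq1 (negPf fj) => /eqP.
apply/matrixP => j k; rewrite (ord1 k) diagE.
by have [fj|/h ->] := boolP (f j t \is a Num.int); [rewrite expi_int // mul1r|rewrite mulr0].
Qed.

(** On the crossing space, a nonzero coordinate of [v] occurs only where [expi (f j t) = 1], so the
    path itself drops out and only the speeds of the phases remain. *)
Let formE t v w : crossing_space Phi t v ->
  omega0 w (path_derivative Phi t *m v) =
  \sum_j 2 * pi * df j t * complex.Re (Num.conj (coord w j 0) * coord v j 0).
Proof.
move=> /crossingP Kv; rewrite path_derivativeE omega0E cplx_mul.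
rewrite -(dotc_unitary _ _ (unitaryJ uP)) coord_path dotcE raddf_sum.
apply: eq_bigr => j _; rewrite mul_diag_mx [X in _ * X]mxE [X in X * coord v j 0]mxE -/(coord w).
have -> : (0 +i* (2 * pi * df j t)) * expi (f j t) * coord v j 0 =
    (0 +i* (2 * pi * df j t)) * coord v j 0.
  by have [fj|/Kv ->] := boolP (f j t \is a Num.int); [rewrite expi_int // mulr1|rewrite !mulr0].
rewrite /= mulrCA; case: (_ * coord v j 0) => a b /=; ring.
Qed.

Lemma diag_path_regular t :
  (forall j, f j t \is a Num.int -> df j t != 0) -> regular_crossing Phi t.
Proof.
move=> df0 v Kv H.
have vK := (crossingP t v).1 Kv.
(* Scaling each coordinate of [v] by its own speed makes the pairing a sum of the nonnegative terms
   2 pi df_j^2 |v_j|^2, whatever the signs of the speeds. *)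
pose x : 'cV[C]_m := \col_j ((df j t)%:C * coord v j 0).
pose w := col_mx (map_mx (@complex.Re R) (P *m x)) (map_mx (@complex.Im R) (P *m x)).
have wx : coord w = x by rewrite /coord /w cplxK mulmxA uP mul1mx.
have Kw : crossing_space Phi t w.
  by apply/crossingP => j /vK vj; rewrite wx mxE vj mulr0.
have := H w Kw; rewrite formE // => /eqP.
rewrite psumr_eq0 => [/allP S0|j _]; last first.
  rewrite wx mxE Re_conjM mulrA -[_ * df j t * df j t]mulrA -expr2.
  apply: mulr_ge0; last by rewrite addr_ge0 ?sqr_ge0.
  by rewrite mulr_ge0 ?sqr_ge0 // mulr_ge0 // pi_ge0.
have cplx0 : cplx 0 = 0 :> 'cV[C]_m by apply/matrixP => i j; rewrite !mxE.
apply: cplx_inj; rewrite cplx0 (cplxE v).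
suff -> : coord v = 0 by rewrite mulmx0.
apply/matrixP => j k; rewrite (ord1 k) [RHS]mxE.
have [fj|/vK//] := boolP (f j t \is a Num.int).
have := S0 j (mem_index_enum j); rewrite wx mxE Re_conjM.
rewrite !mulf_eq0 pnatr_eq0 (gt_eqF (pi_gt0 R)) (negPf (df0 j fj)) /=.
rewrite paddr_eq0 ?sqr_ge0 // !sqrf_eq0 => /andP[vR vI].
by apply/eqP; rewrite eq_complex vR vI.
Qed.

(** In the coordinates [adjoint P] the crossing form is diagonal, and the real and imaginary parts
    of one complex coordinate carry the same coefficient: hence the factor 2. *)
Lemma diag_path_signature t :
  crossing_signature Phi t = \sum_j 2 * crossing_sign (f j) (df j) t.
Proof.
pose X := realify (adjoint P).
pose pr (a : 'I_(m + m)) : 'I_m := match fintype.split a with inl j => j | inr j => j end.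
have prl j : pr (lshift m j) = j by rewrite /pr (unsplitK (inl j)).
have prr j : pr (rshift m j) = j by rewrite /pr (unsplitK (inr j)).
have XcE v : cplx (X *m v) = coord v by rewrite cplx_mul.
have XlE v j : (X *m v) (lshift m j) 0 = complex.Re (coord v j 0).
  by rewrite -XcE [cplx _ _ _]mxE.
have XrE v j : (X *m v) (rshift m j) 0 = complex.Im (coord v j 0).
  by rewrite -XcE [cplx _ _ _]mxE.
have X_unit : X \in unitmx.
  suff : X *m realify P = 1%:M by move=> /mulmx1_unit[].
  by rewrite -realifyM uP realify1.
pose S : {set 'I_(m + m)} := finset (fun a => f (pr a) t \is a Num.int).
have inS a : (a \in S) = (f (pr a) t \is a Num.int) by rewrite inE.
have KP v : crossing_space Phi t v <-> forall a, a \notin S -> (X *m v) a 0 = 0.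
  rewrite crossingP; split => [h a|h j fj].
    by rewrite inS; case: (split_ordP a) => j ->; rewrite ?prl ?prr => /h vj;
      rewrite ?XlE ?XrE vj.
  apply/eqP; rewrite eq_complex -XlE -XrE !h ?eqxx //.
    by rewrite inS prr.
  by rewrite inS prl.
rewrite /crossing_signature (signature_diag X_unit KP (kappa := fun a => 2 * pi * df (pr a) t)).
  rewrite big_mkcond big_split_ord /= -big_split /=; apply: eq_bigr => j _.
  rewrite !inS prl prr /crossing_sign; case: ifP => _; last by rewrite addr0 mulr0.
  by rewrite !sgrM (gtr0_sg (pi_gt0 R)) (gtr0_sg (ltr0Sn R 1)) !mul1r mulr_natl mulr2n.
move=> v Kv; rewrite /crossing_form formE // [RHS]big_mkcond [RHS]big_split_ord /= -[RHS]big_split /=.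
apply: eq_bigr => j _; rewrite !inS prl prr XlE XrE; case: ifPn => fj.
  have := Re_conjM 1 (coord v j 0); rewrite !mul1r => ->; exact: mulrDr.
by rewrite ((crossingP t v).1 Kv j fj) !mulr0 addr0.
Qed.

End DiagonalPath.

(** [Psi] and [A] agree on [[0, l]] only: the flow in a frame is controlled just there, and [A] will
    be its continuous extension. The [a j] are genuine real phases and not classes modulo integers,
    since their sum is the winding of the determinant. *)
Lemma RS_index_unitary (R : realType) (m : nat) (l : R) (A : R -> 'M[R[i]]_m)
    (P : 'M[R[i]]_m) (a : 'I_m -> R) (phi : R -> R) (Psi : R -> 'M[R]_(m + m)) :
  0 < l -> unitary P -> unitary_path l A -> A 0 = 1%:M ->
  A l = P *m diag_mx (\row_j expi (a j)) *m adjoint P ->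
  (forall t, 0 <= t <= l -> {for t, continuous phi}) ->
  (forall t, 0 <= t <= l -> \det (A t) = expi (phi t)) ->
  phi 0 = 0 -> phi l = \sum_j a j ->
  (forall t, 0 <= t <= l -> Psi t = realify (A t)) ->
  RS_index l Psi (\sum_j Q (a j)).
Proof.
move=> l0 uP uA A0 Al cphi dA phi0 phil PsiE.
have /boolp.choice[f] := fun j => exists_profile (a j) l0.
move=> /boolp.choice[df] /boolp.choice[r] prof.
have fd j (t : R) : is_derive t 1 (f j) (df j t) by have [[]] := prof j.
have dfc j : continuous (df j) by have [[]] := prof j.
have f0 j : f j 0 = 0 by have [_ []] := prof j.
have fl j : f j l = a j by have [_ []] := prof j.
have zl : 0 <= (0 : R) <= l by rewrite lexx ltW.
have ll : 0 <= l <= l by rewrite lexx ltW.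
pose B := diag_path P f.
have B0 : B 0 = 1%:M.
  rewrite /B /diag_path (_ : diag_mx _ = 1%:M) ?mulmx1 ?unitaryC //.
  by apply/matrixP => i j; rewrite !mxE f0 expi0.
have Bl : B l = A l.
  rewrite Al /B /diag_path (_ : (\row_j expi (f j l)) = \row_j expi (a j)) //.
  by apply/rowP => j; rewrite !mxE fl.
have fc j : continuous (f j).
  by move=> t; apply: differentiable_continuous; apply/derivable1_diffP; have [] := fd j t.
have detB t : \det (B t) = expi (\sum_j f j t).
  rewrite !det_mulmx det_adjoint mulrAC [_ * Num.conj _]mulrC det_unitary // mul1r det_diag expi_sum.
  by apply: eq_bigr => j _; rewrite mxE.
have [||||||H [cH uH HP HH]] := @path_homotopy _ l l0 m A B phi (fun t => \sum_j f j t) uA.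
- by move=> t tl; split; [exact: diag_path_cont fd _|exact: diag_path_unitary].
- by rewrite A0 B0.
- by rewrite Bl.
- by move=> t tl; split; [exact: cphi|apply: cont_sum => j _; exact: fc].
- by move=> t tl; rewrite dA // detB.
- have S0 : \sum_j f j 0 = 0 by rewrite big1.
  have Sl : \sum_j f j l = \sum_j a j by apply: eq_bigr => j _; rewrite fl.
  by rewrite phi0 phil S0 Sl subrr [RHS]subrr.
exists (fun t => realify (B t)); split.
- exists (fun p => realify (H p)); split.
  + move=> i j; apply: continuous_in_subspaceT => -[s t]; rewrite inE => -[/= s01 tl].
    apply: realify_cont; apply: cH; first by move: s01; rewrite in_itv.
    by move: tl; rewrite in_itv.
  + by move=> s t s01 tl; apply: symplectic_realify; exact: uH.
  + by move=> t tl; have [-> ->] := HP t tl; rewrite PsiE.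
  + by move=> s s01; have [-> ->] := HH s s01; rewrite !PsiE.
- exact: (@diag_path_C1 R m P f df fd dfc).
- move=> t tl; apply: (diag_path_regular uP fd) => j fj.
  by have [_ _ + _ _] := prof j; apply.
- rewrite /crossing_number !(diag_path_signature uP fd).
  under eq_fsbigr do rewrite (diag_path_signature uP fd).
  (* A common finite support for the crossings of all phases, which allows the sums over times and
     over phases to be exchanged. *)
  pose u := undup (flatten [seq r j | j <- enum 'I_m]).
  have uE t : (t \in u) = [exists j, t \in r j].
    rewrite mem_undup; apply/flattenP/existsP => [[_ /mapP[j _ ->]]|[j tj]]; first by exists j.
    by exists (r j) => //; apply: map_f; rewrite mem_enum.
  have u_sub : [set` u] `<=` [set` `]0, l[].
    move=> t /=; rewrite uE => /existsP[j].
    by have [_ _ _ [rl _] _] := prof j; move=> /rl.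
  have u_supp j t : 0 < t < l -> t \notin u -> crossing_sign (f j) (df j) t = 0.
    move=> tl; rewrite uE => /existsPn /(_ j) tr.
    have [_ _ _ [_ /(_ t tl tr) ft] _] := prof j.
    by rewrite /crossing_sign (negPf ft).
  rewrite (fsbigE u) ?undup_uniq //; last first.
    move=> t /=; rewrite in_itv /= => tl tu; rewrite big1 // => j _.
    by rewrite u_supp // mulr0.
  rewrite exchange_big /= !mulr_sumr -!big_split /=; apply: eq_bigr => j _.
  have [_ _ _ _ <-] := prof j.
  rewrite [in RHS](fsbigE u) ?undup_uniq //; last first.
    by move=> t /=; rewrite in_itv /= => tl tu; rewrite u_supp // mulr0.
  by rewrite !mulKf ?pnatr_eq0.
Qed.

(** * Frames of ker dW along an orbit *)

Import (canonicals) mpoly.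

(** * Partial derivatives under diagonal scalings *)

Section Polynomial.
Variables (R : realType) (n : nat).
Local Notation C := R[i].
Implicit Types (W : mpoly.mpoly n C) (z d : 'cV[C]_n).

(** The restriction of [W] to a coordinate line. Its derivative at 0 links the formal partial
    derivative to the values of [W], on which the symmetries are expressed. *)
Definition line_poly W z (i : 'I_n) : {poly C} :=
  mpoly.mmap polyC (fun k => (z k 0)%:P + (k == i)%:R *: 'X) W.

Lemma horner_line_poly W z i x :
  (line_poly W z i).[x] = weval W (z + x *: delta_mx i 0).
Proof.
rewrite /line_poly /weval mpoly.mevalE /mpoly.mmap horner_sum; apply: eq_bigr => m _.
rewrite hornerM hornerC /mpoly.mmap1 horner_prod; congr (_ * _); apply: eq_bigr => k _.
by rewrite horner_exp !hornerE !mxE andbT mulrC.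
Qed.

(** Both sides are derivations over the evaluation at [z]; agreement on the variables propagates to
    monomials and then to linear combinations. *)
Lemma deriv_line_poly W z i : (line_poly W z i)^`().[0] = wpartial W i z.
Proof.
pose L := mpoly.mmap polyC (fun k => (z k 0)%:P + (k == i)%:R *: 'X : {poly C}).
pose ev := mpoly.meval (fun k => z k 0).
have L0 p : (L p).[0] = ev p.
  have := horner_line_poly p z i 0; rewrite scale0r addr0; exact.
pose D p := (L p)^`().[0] = ev (mpoly.mderiv i p).
have DM p q : D p -> D q -> D (p * q).
  rewrite /D mpoly.mderivM (_ : L (p * q) = L p * L q); last exact: rmorphM.
  rewrite derivM hornerD !hornerM !L0 => -> ->.
  by rewrite /ev mpoly.mevalD !mpoly.mevalM.
have D1 : D 1.
  rewrite /D (_ : L 1 = 1); last exact: rmorph1.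
  by rewrite -[1]/(1%:P) derivC horner0 -mpoly.mpolyC1 mpoly.mderivC /ev mpoly.meval0.
have DX k : D (mpoly.mpolyX C (mpoly.mnm1 k)).
  rewrite /D /L mpoly.mmapX mpoly.mmap1U derivD derivC derivZ derivX !hornerE.
  rewrite mpoly.mderivX mpoly.mnm1E /ev mpoly.mevalZ; case: eqVneq => [->|]; last by rewrite !mul0r.
  by rewrite -[X in mpoly.mnm_sub X]mpoly.add0m mpoly.addmK mpoly.mpolyX0 mpoly.meval1 mulr1.
have DXn k e : D (mpoly.mpolyX C (mpoly.mnm1 k) ^+ e).
  by elim: e => [|e IHe]; rewrite ?expr0 // exprS; exact: DM.
have DXm m : D (mpoly.mpolyX C m).
  rewrite mpoly.mpolyXE_id; elim/big_rec: _ => // k p _; exact: DM.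
elim/mpoly.mpolyind: W => [|c m p _ _ IHp].
  by rewrite /line_poly raddf0 /= deriv0 horner0 /wpartial mpoly.mderiv0 rmorph0.
rewrite /line_poly -mpoly.mul_mpolyC raddfD /= rmorphM /= mpoly.mmapC derivD hornerD mul_polyC derivZ hornerZ.
rewrite /wpartial mpoly.mderivD mpoly.mderiv_mulC !rmorphD rmorphM /= mpoly.mevalC.
by congr (_ * _ + _); [exact: DXm|exact: IHp].
Qed.

Lemma poly_eq_horner (p q : {poly C}) : (forall x, p.[x] = q.[x]) -> p = q.
Proof.
move=> pq; apply/eqP; rewrite -subr_eq0; apply/negP => /negP pq0.
pose s := [seq i%:R : C | i <- iota 0 (size (p - q))].
have : all (root (p - q)) s by apply/allP => x _; rewrite rootE hornerD hornerN pq subrr.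
move=> /(max_poly_roots pq0).
rewrite map_inj_uniq ?iota_uniq => [/(_ isT)|i j]; last by move/eqP; rewrite eqr_nat => /eqP.
by rewrite size_map size_iota ltnn.
Qed.

Lemma cdiagE d z i : (cdiag d *m z) i 0 = d i 0 * z i 0.
Proof. by rewrite /cdiag mul_diag_mx !mxE. Qed.

(** Chain rule along a coordinate line. The hypothesis concerns values; it becomes an identity of
    polynomials in one variable because the field is infinite, and can then be differentiated. *)
Lemma wpartial_diag W d (lam : C) :
  (forall z, weval W (cdiag d *m z) = lam * weval W z) ->
  forall z i, d i 0 * wpartial W i (cdiag d *m z) = lam * wpartial W i z.
Proof.
move=> Wd z i.
have E : line_poly W (cdiag d *m z) i \Po (d i 0 *: 'X) = lam *: line_poly W z i.
  apply: poly_eq_horner => x; rewrite horner_comp !hornerZ hornerX !horner_line_poly -Wd.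
  congr (weval W _); rewrite mulmxDr; congr (_ + _).
  apply/matrixP => k j; rewrite (ord1 j) cdiagE !mxE andbT.
  by case: eqVneq => [->|]; rewrite ?mulr1 ?mulr0 // mulr1.
have := congr1 (fun p : {poly C} => p^`().[0]) E.
rewrite /= deriv_comp !derivZ derivX hornerM horner_comp !hornerZ hornerX mulr0 hornerC mulr1.
rewrite !deriv_line_poly => <-.
by rewrite mulrC.
Qed.

Lemma dW_diag W d (lam : C) :
  (forall z, weval W (cdiag d *m z) = lam * weval W z) ->
  forall z, dW W (cdiag d *m z) *m cdiag d = lam *: dW W z.
Proof.
move=> Wd z; apply/rowP => i; rewrite /cdiag mul_mx_diag !mxE -(wpartial_diag Wd) mulrC.
by [].
Qed.

End Polynomial.

(** * Unitary frames orthogonal to a vector *)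

Section Frames.
Variables (R : realType) (m : nat).
Local Notation C := R[i].
Implicit Types (nu v : 'cV[C]_m.+1) (F : 'M[C]_(m.+1, m)).

Lemma frame_unitary nu F : nu != 0 -> adjoint nu *m F = 0 -> adjoint F *m F = 1%:M ->
  unitary (row_mx (normalize nu) F : 'M[C]_(1 + m)).
Proof.
move=> nu0 nuF FF.
have adj_row (A : 'cV[C]_m.+1) (B : 'M[C]_(m.+1, m)) :
    adjoint (row_mx A B) = col_mx (adjoint A) (adjoint B).
  by rewrite /adjoint map_row_mx tr_row_mx.
rewrite /unitary adj_row mul_col_row FF.
have -> : adjoint (normalize nu) *m F = 0.
  by rewrite /normalize adjointZ -scalemxAl nuF scaler0.
have -> : adjoint F *m normalize nu = 0.
  rewrite /normalize -scalemxAr -[adjoint F *m nu]adjointK adjointM adjointK nuF.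
  by rewrite adjoint0 scaler0.
rewrite [X in block_mx X]mx11_scalar -/(dotc _ _) dotc_normalize //.
by rewrite -scalar_mx_block.
Qed.

Lemma frame_decomposition nu F v :
  nu != 0 -> adjoint nu *m F = 0 -> adjoint F *m F = 1%:M ->
  v = (dotc nu v / dotc nu nu) *: nu + F *m (adjoint F *m v).
Proof.
move=> nu0 nuF FF; have uU := unitaryC (frame_unitary nu0 nuF FF).
rewrite /adjoint map_row_mx tr_row_mx -/(adjoint _) mul_row_col -/(adjoint F) in uU.
rewrite -{1}[v]mul1mx -uU mulmxDl -!mulmxA; congr (_ + _).
rewrite [adjoint _ *m v]mx11_scalar -/(dotc _ _) mul_mx_scalar dotcZl /normalize scalerA.
congr (_ *: _); rewrite [Num.conj _]conjc_real dotcc.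
have s0 : Num.sqrt (sqnorm nu) != 0 by rewrite gt_eqF // sqrtr_gt0 sqnorm_gt0.
rewrite mulrAC -rmorphM mulrC; congr (_ * _); rewrite -fmorphV -invfM -expr2.
by rewrite sqr_sqrtr // sqnorm_ge0.
Qed.

Lemma frame_kernel nu F v : nu != 0 -> adjoint nu *m F = 0 -> adjoint F *m F = 1%:M ->
  dotc nu v = 0 -> F *m (adjoint F *m v) = v.
Proof.
move=> nu0 nuF FF nuv; rewrite [RHS](frame_decomposition v nu0 nuF FF) nuv mul0r scale0r.
by rewrite add0r.
Qed.

Lemma frame_kernelM p nu F (B : 'M[C]_(m.+1, p)) :
  nu != 0 -> adjoint nu *m F = 0 -> adjoint F *m F = 1%:M ->
  adjoint nu *m B = 0 -> F *m (adjoint F *m B) = B.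
Proof.
move=> nu0 nuF FF nuB; apply/matrixP => i j.
have := congr1 (fun x : 'cV_ _ => x i 0) (@frame_kernel nu F (col j B) nu0 nuF FF _).
rewrite !colE !mulmxA -!colE !mxE; apply.
by rewrite /dotc colE mulmxA nuB mul0mx mxE.
Qed.

(** Column operations remove from [v] its component in the span of [F]. When [nu] is the adjoint of
    dW, the factor [dotc nu v] is dW applied to [v], and the quotient by it is the residue. *)
Lemma det_row_mx_frame nu F v : nu != 0 -> adjoint nu *m F = 0 -> adjoint F *m F = 1%:M ->
  \det (row_mx v F : 'M[C]_(1 + m)) =
  dotc nu v / dotc nu nu * \det (row_mx nu F : 'M[C]_(1 + m)).
Proof.
move=> nu0 nuF FF; pose a := dotc nu v / dotc nu nu; pose y := adjoint F *m v.
have -> : (row_mx v F : 'M[C]_(1 + m)) = row_mx nu F *m block_mx a%:M 0 y 1%:M.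
  rewrite mul_row_block mulmx0 mulmx1 add0r mul_mx_scalar.
  by rewrite -(frame_decomposition v nu0 nuF FF).
by rewrite det_mulmx det_lblock det1 mulr1 det_scalar1 mulrC.
Qed.

Lemma det_frame_neq0 nu F : nu != 0 -> adjoint nu *m F = 0 -> adjoint F *m F = 1%:M ->
  \det (row_mx nu F : 'M[C]_(1 + m)) != 0.
Proof.
move=> nu0 nuF FF; have := det_unitary (frame_unitary nu0 nuF FF).
rewrite (det_row_mx_frame _ nu0 nuF FF) => E; apply: contra_eq_neq E => ->.
by rewrite !mulr0 eq_sym oner_eq0.
Qed.

(* E is made of columns of a reflection sending a coordinate vector to the
   normal: it acts on the support of nu only, where d is scalar. *)
Lemma exists_eigenframe nu (d : 'rV[C]_m.+1) i0 : nu i0 0 != 0 ->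
  (forall i, nu i 0 != 0 -> d 0 i = d 0 i0) ->
  exists E : 'M[C]_(m.+1, m),
  [/\ adjoint nu *m E = 0, adjoint E *m E = 1%:M
    & diag_mx d *m E = E *m diag_mx (\row_j d 0 (lift i0 j))].
Proof.
move=> nui0 nud.
have nu0 : nu != 0 by apply: contraNneq nui0 => ->; rewrite mxE.
pose u : 'cV[C]_m.+1 := delta_mx i0 0; pose v := normalize nu.
have v1 : dotc v v = 1 by exact: dotc_normalize.
have u1 : dotc u u = 1.
  rewrite dotcE (bigD1 i0) //= big1 => [|i]; first by rewrite !mxE !eqxx rmorph1 mulr1 addr0.
  by rewrite !mxE andbT => /negPf->; rewrite mulr0.
have [S [uS SuE SD]] : exists S : 'M[C]_m.+1,
    [/\ unitary S, S *m u = v & diag_mx d *m S = S *m diag_mx d].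
  (* For [u = v] the vector [a] below vanishes and the reflection degenerates. *)
  have [uv|uv] := eqVneq u v.
    by exists 1%:M; split; rewrite ?mul1mx ?mulmx1 //; exact: unitary1.
  pose a := u - v.
  have dotcNl (x y : 'cV[C]_m.+1) : dotc (- x) y = - dotc x y.
    by rewrite /dotc adjointN mulNmx mxE.
  have dotcNr (x y : 'cV[C]_m.+1) : dotc x (- y) = - dotc x y.
    by rewrite /dotc mulmxN mxE.
  have aE : dotc a u + Num.conj (dotc a u) = dotc a a.
    by rewrite conj_dotc /a !(dotcDl, dotcDr, dotcNl, dotcNr) u1 v1; ring.
  have b0 : dotc a u != 0.
    apply: contra_neq uv => b0; move: aE; rewrite b0 rmorph0 addr0 dotcc => /esym/eqP.
    by rewrite fmorph_eq0 sqnorm_eq0 subr_eq0 => /eqP.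
  (* [a] is supported where [d] takes the value [d 0 i0], so its projector commutes with
     [diag_mx d]. *)
  have ad i : a i 0 != 0 -> d 0 i = d 0 i0.
    rewrite !mxE andbT; have [->//|_] := eqVneq i i0; rewrite sub0r oppr_eq0 mulf_eq0 negb_or.
    by move=> /andP[_]; exact: nud.
  exists (reflection (dotc a u) a); split; first exact: reflection_unitary.
    by rewrite reflection_mul mulVf // scale1r opprB addrC subrK.
  rewrite /reflection mulmxBr [RHS]mulmxBl mulmx1 [in RHS]mul1mx -scalemxAl -scalemxAr.
  congr (_ - _ *: _).
  apply/matrixP => i j; rewrite mul_diag_mx mul_mx_diag !mxE !big_ord1 !mxE.
  have [ai|/ad->] := eqVneq (a i 0) 0; first by rewrite !mxE in ai; rewrite ai !mul0r mulr0.
  have [aj|/ad->] := eqVneq (a j 0) 0; last by rewrite mulrC.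
  by rewrite !mxE in aj; rewrite aj rmorph0 !mulr0 mul0r.
have dS : adjoint S *m v = u by rewrite -SuE mulmxA uS mul1mx.
pose pk : 'M[C]_(m.+1, m) := \matrix_(i, j) (i == lift i0 j)%:R.
have upk : adjoint u *m pk = 0.
  apply/matrixP => i j; rewrite mxE big1 ?[RHS]mxE // => k _; rewrite !mxE.
  have [->|] := eqVneq k i0; first by rewrite (negPf (neq_lift _ _)) mulr0.
  by move=> _; rewrite rmorph0 mul0r.
have pkpk : adjoint pk *m pk = 1%:M.
  apply/matrixP => i j; rewrite mxE (bigD1 (lift i0 i)) //= big1 ?addr0 => [|k].
    by rewrite !mxE eqxx rmorph1 mul1r (inj_eq lift_inj).
  by rewrite !mxE => /negPf->; rewrite rmorph0 mul0r.
exists (S *m pk); split.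
- rewrite (normalizeE nu0) -/v adjointZ -scalemxAl mulmxA.
  have -> : adjoint v *m S = adjoint u by rewrite -dS adjointM adjointK.
  by rewrite upk scaler0.
- by rewrite adjointM -mulmxA [adjoint S *m _]mulmxA uS mul1mx.
- rewrite mulmxA SD -!mulmxA; congr (_ *m _); apply/matrixP => i j.
  rewrite mul_diag_mx mul_mx_diag !mxE; have [->|] := eqVneq i (lift i0 j).
    by rewrite mulr1 mul1r.
  by rewrite mulr0 mul0r.
Qed.

End Frames.

(** * The Reeb flow, the normal line and the volume form along an orbit *)

Section Orbit.
Variables (R : realType) (m : nat) (W : mpoly.mpoly m.+1 R[i]) (w : 'I_m.+1 -> nat) (h : nat).
Hypothesis hwt : has_weight W w h.
Local Notation C := R[i].
Implicit Types (z : 'cV[C]_m.+1).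

Let h_neq0 : h%:R != 0 :> R.
Proof. by have [_ h0 _ _] := hwt; rewrite pnatr_eq0 -lt0n. Qed.

(** The Reeb flow is the weighted scaling by [expi (t / h)], whose [h]-th power is [expi t]. *)
Lemma weval_reeb (t : R) z : weval W (reeb w h t *m z) = expi t * weval W z.
Proof.
have [_ _ _ /(_ (expi (t / h%:R)) z)] := hwt.
rewrite expiX divfK // => <-; congr weval.
apply/matrixP => i j; rewrite (ord1 j) /reeb cdiagE !mxE expiX /theta_J.
by congr (expi _ * _); field.
Qed.

Lemma dW_reeb (t : R) z : dW W (reeb w h t *m z) *m reeb w h t = expi t *: dW W z.
Proof. by apply: dW_diag => z'; exact: weval_reeb. Qed.

Lemma reeb_unitary (t : R) : unitary (reeb w h t).
Proof.
rewrite /reeb /cdiag (_ : _^T = \row_j expi (theta_J w h j * t)); first exact: unitary_diag_expi.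
by apply/rowP => j; rewrite !mxE.
Qed.

Lemma reeb0 : reeb w h (0 : R) = 1%:M.
Proof.
by apply/matrixP => i j; rewrite !mxE mulr0 expi0.
Qed.

Lemma det_reeb (t : R) : \det (reeb w h t) = expi ((\sum_i theta_J w h i) * t).
Proof.
rewrite /reeb /cdiag det_diag mulr_suml expi_sum; apply: eq_bigr => i _.
by rewrite !mxE.
Qed.

Lemma reeb_cont (t : R) : mcont (fun t => reeb w h t) t.
Proof.
apply: mcont_diag => i j; under eq_fun do rewrite !mxE.
apply: ccont_expi; apply: continuousM; [exact: cst_continuous|exact: cvg_id].
Qed.

(* Weighted rescaling moves a critical point into any neighbourhood of 0. *)
Lemma dW_neq0 z : isolated_singularity W -> z != 0 -> dW W z != 0.
Proof.
move=> [_ [eps [eps0 iso]]] z0; apply/eqP => dz0.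
have [w0 h0 _ Ww] := hwt.
have d0 : 0 < Num.sqrt (sqnorm z) by rewrite sqrtr_gt0 sqnorm_gt0.
(* The minimum with 1 makes every [lam ^+ w i] at most [lam], the weights being positive; the factor
   2 makes the bound on the norm strict. *)
pose lam := Num.min 1 (eps / (2 * Num.sqrt (sqnorm z))).
have lam0 : 0 < lam by rewrite lt_min ltr01 divr_gt0 // mulr_gt0.
have lam1 : lam <= 1 by rewrite ge_min lexx.
have lamC n : (lam%:C) ^+ n != 0 by rewrite expf_neq0 // fmorph_eq0 gt_eqF.
pose d : 'cV[C]_m.+1 := \col_i (lam%:C) ^+ w i.
have Wd z' : weval W (cdiag d *m z') = lam%:C ^+ h * weval W z'.
  rewrite -Ww; congr weval; apply/matrixP => i j.
  by rewrite (ord1 j) cdiagE !mxE.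
have : dW W (cdiag d *m z) = 0.
  apply/rowP => i; have := wpartial_diag Wd z i.
  have -> : wpartial W i z = 0 by have := congr1 (fun v : 'rV_ _ => v 0 i) dz0; rewrite !mxE.
  by rewrite mulr0 !mxE => /eqP; rewrite mulf_eq0 (negPf (lamC _)) => /eqP.
have small : sqnorm (cdiag d *m z) < eps ^+ 2.
  apply: (@le_lt_trans _ _ ((lam * Num.sqrt (sqnorm z)) ^+ 2)).
    rewrite exprMn sqr_sqrtr ?sqnorm_ge0 // /sqnorm mulr_sumr; apply: ler_sum => i _.
    rewrite cdiagE mxE -rmorphXn /=; case: (z i 0) => a b /=.
    rewrite !mul0r subr0 addr0 !exprMn -mulrDr ler_wpM2r ?addr_ge0 ?sqr_ge0 //.
    rewrite ler_sqr ?nnegrE ?exprn_ge0 ?(ltW lam0) //.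
    by rewrite -[leRHS]expr1 ler_wiXn2l // ltW.
  rewrite ltr_sqr ?nnegrE ?mulr_ge0 ?(ltW lam0) ?(ltW d0) ?(ltW eps0) //.
  rewrite -ltr_pdivlMr //; apply: (@le_lt_trans _ _ (eps / (2 * Num.sqrt (sqnorm z)))).
    by rewrite ge_min lexx orbT.
  by rewrite ltr_pM2l // ltf_pV2 ?posrE ?mulr_gt0 // ltr_pMl // ltr1n.
move=> /(iso _ small) dz; case/eqP: z0; apply/matrixP => i j; rewrite (ord1 j) [RHS]mxE.
have := congr1 (fun v : 'cV_ _ => v i 0) dz; rewrite /= cdiagE !mxE => /eqP.
by rewrite mulf_eq0 (negPf (lamC _)) => /eqP.
Qed.

Variables (z : 'cV[C]_m.+1) (l : R).
Hypotheses (l0 : 0 < l) (dz : dW W z != 0).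

Definition normal (t : R) : 'cV[C]_m.+1 := adjoint (dW W (reeb w h t *m z)).

Lemma normalE t : normal t = expi (- t) *: (reeb w h t *m normal 0).
Proof.
have := congr1 (fun X => reeb w h t *m adjoint X) (dW_reeb t z).
rewrite adjointM adjointZ mulmxA (unitaryC (reeb_unitary t)) mul1mx conj_expi -scalemxAr.
by rewrite /normal reeb0 mul1mx.
Qed.

Lemma normal0_neq0 : normal 0 != 0.
Proof.
rewrite /normal reeb0 mul1mx; apply: contra dz => /eqP dz0.
by rewrite -[dW W z]adjointK dz0 adjoint0.
Qed.

Lemma normal_dot t : dotc (normal t) (normal t) = dotc (normal 0) (normal 0).
Proof.
rewrite normalE dotcZl dotcZr conj_expi opprK mulrA expiM_N mul1r dotc_unitary //.
exact: reeb_unitary.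
Qed.

Lemma reeb_normal t : reeb w h t *m normal 0 = expi t *: normal t.
Proof. by rewrite [in RHS]normalE scalerA expiM_N scale1r. Qed.

Lemma normal_neq0 t : normal t != 0.
Proof.
apply: contraNneq normal0_neq0 => nt0.
rewrite -[normal 0]mul1mx -(reeb_unitary t) -mulmxA reeb_normal nt0.
by rewrite scaler0 mulmx0.
Qed.

Variable F : R -> 'M[C]_(m.+1, m).
Hypothesis Fc : mx_continuous l F.
Hypothesis Fker : forall t, 0 <= t <= l -> dW W (reeb w h t *m z) *m F t = 0.
Hypothesis FF : forall t, 0 <= t <= l -> adjoint (F t) *m F t = 1%:M.

Let zl : 0 <= (0 : R) <= l. Proof. by rewrite lexx ltW. Qed.
Let ll : 0 <= l <= l. Proof. by rewrite lexx ltW. Qed.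

Let nuF t : 0 <= t <= l -> adjoint (normal t) *m F t = 0.
Proof. by move=> tl; rewrite /normal adjointK Fker. Qed.

Let A t := flow_in_frame w h F t.

Lemma reeb_frame t : 0 <= t <= l -> reeb w h t *m F 0 = F t *m A t.
Proof.
move=> tl; rewrite /A /flow_in_frame.
rewrite (frame_kernelM (normal_neq0 t) (nuF tl) (FF tl)) //.
rewrite /normal adjointK mulmxA dW_reeb -scalemxAl.
by have := Fker zl; rewrite reeb0 mul1mx => ->; rewrite scaler0.
Qed.

Lemma flow_unitary t : 0 <= t <= l -> unitary (A t).
Proof.
move=> tl; rewrite /unitary.
have -> : adjoint (A t) *m A t = adjoint (F t *m A t) *m (F t *m A t).
  by rewrite adjointM -mulmxA [adjoint (F t) *m (_ *m _)]mulmxA FF // mul1mx.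
rewrite -(reeb_frame tl) adjointM -mulmxA [adjoint (reeb _ _ _) *m _]mulmxA.
by rewrite (reeb_unitary t) mul1mx (FF zl).
Qed.

Let M t : 'M[C]_(1 + m) := row_mx (normal t) (F t).

(** The value obtained by testing [is_residue] on the normal vector itself. The norm of the normal
    is constant along the orbit, so the denominator is frozen at time 0 and only the determinant
    winds. *)
Definition residue t : C := \det (M t) / dotc (normal 0) (normal 0).

Lemma residueP t : 0 <= t <= l -> is_residue W (reeb w h t *m z) (F t) (residue t).
Proof.
move=> tl v; rewrite (det_row_mx_frame v (normal_neq0 t) (nuF tl) (FF tl)) normal_dot.
have -> : (dW W (reeb w h t *m z) *m v) 0 0 = dotc (normal t) v.
  by rewrite /dotc /normal adjointK.
by rewrite /residue mulrA mulrAC.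
Qed.

Let dot0 : dotc (normal 0) (normal 0) != 0.
Proof. by rewrite dotcc fmorph_eq0 sqnorm_eq0 normal0_neq0. Qed.

Lemma residue_neq0 t : 0 <= t <= l -> residue t != 0.
Proof.
move=> tl; rewrite mulf_neq0 ?invr_neq0 //.
exact: (det_frame_neq0 (normal_neq0 t) (nuF tl) (FF tl)).
Qed.

Lemma det_flow t : 0 <= t <= l ->
  \det (reeb w h t) * residue 0 = expi t * \det (A t) * residue t.
Proof.
move=> tl; rewrite /residue !mulrA; congr (_ / _).
have E : reeb w h t *m M 0 = M t *m block_mx (expi t)%:M 0 0 (A t).
  rewrite /M mul_mx_row mul_row_block !mulmx0 addr0 add0r mul_mx_scalar.
  by rewrite reeb_normal (reeb_frame tl).
have := congr1 determinant E.
rewrite !det_mulmx (@det_lblock _ 1 m) det_scalar1 => ->; ring.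
Qed.

Let ext t := F (clamp l t).

Let ext_cont t : mcont ext t.
Proof.
move=> i j; have [cR cI] := Fc i j; split.
  exact: (@continuous_comp_clamp _ l (fun t => complex.Re (F t i j)) (ltW l0) cR).
exact: (@continuous_comp_clamp _ l (fun t => complex.Im (F t i j)) (ltW l0) cI).
Qed.

Lemma flow_path : unitary_path l (fun t => A (clamp l t)).
Proof.
move=> t tl; split; last by rewrite clamp_id //; exact: flow_unitary.
apply: mcontM; first by apply: mcontJ; exact: ext_cont.
apply: mcontM; last exact: mcont_cst.
apply: (@mcont_comp _ _ _ _ _ (clamp l) (fun t => reeb w h t)); first exact: continuous_clamp.
exact: reeb_cont.
Qed.

Lemma residue_cont t : ccont (fun t => residue (clamp l t)) t.
Proof.
apply: ccontM; last exact: ccont_cst.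
apply: ccont_det; apply: mcont_row_mx; last exact: ext_cont.
have cn s : mcont normal s.
  have -> : normal = (fun s => expi (- s) *: (reeb w h s *m normal 0)).
    by apply/funext => s'; exact: normalE.
  apply: mcontZ; first by apply: ccont_expi; apply: continuousN; exact: cvg_id.
  by apply: mcontM; [exact: reeb_cont|exact: mcont_cst].
by apply: (@mcont_comp _ _ _ _ _ (clamp l) normal); [exact: continuous_clamp|exact: cn].
Qed.

(* The determinant of the flow has the winding of the ambient flow, minus that
   of the normal direction, minus that of the volume form. *)
Lemma residue_lift : exists phi : R -> R,
  [/\ forall t, 0 <= t <= l -> {for t, continuous phi},
      arg_branch l residue phi
    & forall t, 0 <= t <= l ->
        \det (A t) = expi ((\sum_i theta_J w h i) * t - t - (phi t - phi 0))].
Proof.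
have [|phi [cphi phiP]] := arg_lift (u := fun t => residue (clamp l t)) l0.
  by move=> t tl; split; [exact: residue_cont|rewrite clamp_id ?residue_neq0].
have resP t : 0 <= t <= l -> exists r : R, 0 < r /\ residue t = r%:C * expi (phi t).
  by move=> tl; have := phiP t tl; rewrite clamp_id.
exists phi; split=> //.
  by split=> //; apply: continuous_in_subspaceT => t; rewrite inE /= in_itv /=; exact: cphi.
move=> t tl; have [r [r0 rE]] := resP t tl; have [s [s0 sE]] := resP 0 zl.
have := det_flow tl; rewrite rE sE det_reeb => E.
have rC : r%:C != 0 by rewrite fmorph_eq0 gt_eqF.
(* Comparing polar forms leaves a positive factor [s / r], which unitarity of the flow forces to be
   1. *)
have {}E : \det (A t) = (s / r)%:C *
    expi ((\sum_i theta_J w h i) * t - t - (phi t - phi 0)).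
  rewrite !expiD opprB expiD rmorphM fmorphV -!expiV /=.
  apply: (mulfI (expi_neq0 t)); apply: (mulIf rC); apply: (mulIf (expi_neq0 (phi t))).
  transitivity (expi t * \det (A t) * (r%:C * expi (phi t))); first by ring.
  by rewrite -E; field; rewrite !expi_neq0 rC.
have := det_unitary (flow_unitary tl).
rewrite E rmorphM /= conj_expi [Num.conj _]conjc_real mulrACA -rmorphM /= -expiD addNr.
rewrite expi0 mulr1 => /complexI /eqP; rewrite -expr2 sqrp_eq1 ?divr_ge0 ?ltW // => /eqP ->.
by rewrite rmorph1 mul1r.
Qed.

End Orbit.

(** * Integer corrections of the winding and the final count *)

Section Assembly.
Variable R : realType.

(** Serves the case [m = 0], where every determinant is 1 and no phase can take up an integer
    winding. *)
Lemma int_valued_path (l : R) (psi : R -> R) : 0 < l ->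
  (forall t, 0 <= t <= l -> {for t, continuous psi}) ->
  (forall t, 0 <= t <= l -> psi t \is a Num.int) -> psi 0 = 0 -> psi l = 0.
Proof.
move=> l0 cpsi ipsi psi0; apply/eqP; apply: contraT => psil.
have ll : 0 <= l <= l by rewrite lexx ltW.
have l1 : 1 <= `|psi l|.
  by have := ipsi l ll; move: psil => /norm_intr_ge1 H /H.
(* Since [psi l] has absolute value at least 1, this half-integer lies between 0 and [psi l] and
   would be attained. *)
pose v := Num.sg (psi l) / 2.
have [||c cl cv] := @IVT R psi 0 l v (ltW l0).
- apply: continuous_in_subspaceT => t; rewrite inE /= in_itv /=; exact: cpsi.
- rewrite psi0 /v ge_min le_max; move: l1 psil.
  case: (ltgtP (psi l) 0) => [p|p|->]; last by rewrite normr0 => *; lra.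
    by rewrite (ltr0_sg p) (ltr0_norm p) => *; apply/andP; split; apply/orP; [right|left]; lra.
  by rewrite (gtr0_sg p) (gtr0_norm p) => *; apply/andP; split; apply/orP; [left|right]; lra.
have vi : v \is a Num.int by rewrite -cv; apply: ipsi; move: cl; rewrite in_itv.
have v0 : v != 0 by rewrite mulf_neq0 ?sgr_eq0 // invr_eq0 pnatr_eq0.
have := norm_intr_ge1 vi v0; rewrite /v normrM normr_sg psil mul1r ger0_norm ?invr_ge0 //.
lra.
Qed.

(** An integer added to a phase changes neither its exponential nor the endpoint, and [Q] by twice
    that integer. The whole discrepancy is charged to the first phase; without any phase, both sums
    are 0 and so must be [D]. *)
Lemma distribute_shift m (b : 'I_m -> R) (D : R) :
  D - \sum_j b j \is a Num.int -> (m = 0%N -> D = 0) ->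
  exists a : 'I_m -> R, [/\ forall j, expi (a j) = expi (b j), \sum_j a j = D
    & \sum_j Q (a j) = \sum_j Q (b j) + 2 * (D - \sum_j b j)].
Proof.
case: m b => [|m] b kD D0.
  by exists b; rewrite !big_ord0 D0 // subr0 mulr0 addr0; split=> // -[].
set k := D - _ in kD *.
exists (fun j => b j + (if j == 0 then k else 0)); split.
- move=> j; rewrite expiD; case: ifP => _; first by rewrite (expi_int kD) mulr1.
  by rewrite expi0 mulr1.
- by rewrite big_split -big_mkcond big_pred1_eq /= /k addrC subrK.
- rewrite (eq_bigr (fun j => Q (b j) + (if j == 0 then 2 * k else 0))) => [|j _].
    by rewrite big_split -big_mkcond big_pred1_eq.
  by case: ifP => _; [exact: QD_int|rewrite !addr0].
Qed.

(** The dropped index [i0] lies outside [S], which lowers the count of the complement by one: it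
    stands for the normal direction. *)
Lemma sum_lift_partition m (S : {set 'I_m.+1}) (x : 'I_m.+1 -> R) (y : R) i0 :
  i0 \notin S ->
  \sum_(j < m) (if lift i0 j \in S then x (lift i0 j) else y) =
  \sum_(i in S) x i + (#|~: S|%:R - 1) * y.
Proof.
move=> i0S; have : \sum_i (if i \in S then x i else y) = \sum_(i in S) x i + #|~: S|%:R * y.
  rewrite (bigID (mem S)) /=; congr (_ + _); first by apply: eq_bigr => i ->.
  rewrite (eq_bigr (fun=> y)) => [|i /negPf-> //].
  rewrite sumr_const mulr_natl; congr (_ *+ _); apply: eq_card => i.
  by rewrite !inE.
rewrite (bigD1_ord i0) //= (negPf i0S) => E.
by apply: (addrI y); rewrite E mulrBl mul1r addrCA [y + _]addrC subrK.
Qed.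

End Assembly.

Lemma mx_continuous_mcont (R : realType) p q (l : R) (F : R -> 'M[R[i]]_(p, q)) :
  (forall t, mcont F t) -> mx_continuous l F.
Proof.
move=> cF i j; split; apply: continuous_in_subspaceT => t _; by have [] := cF t i j.
Qed.

Theorem proposition8p15 (R : realType) (m : nat)
    (W : mpoly.mpoly m.+1 (complex R)) (w : 'I_m.+1 -> nat) (h : nat)
    (hwt : has_weight W w h) (hnd : nondegenerate_poly W)
    (g : 'cV[complex R]_m.+1) (hg : G_W W g)
    (theta : 'I_m.+1 -> R)
    (htheta : forall i, 0 <= theta i < 1 /\ g i 0 = expi (theta i))
    (delta l : R) (hdelta : 0 < delta) (hl : 0 < l)
    (hSigma : Sigma W w h theta delta l !=set0) :
  let I := I_gl W w h theta l in
  mu_RS W w h g theta delta l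
    (2 * (- (\sum_(i in I) theta i)
          + \sum_(j in ~: I) (l * theta_J w h j - l))
     + \sum_(i in I) Q (l * theta_J w h i + theta i)
     + (#|~: I|%:R - 1) * Q l).
Proof.
move=> I; split=> // z [zfix [_ zdelta]].
have z0 : z != 0 by rewrite -sqnorm_gt0 zdelta exprn_gt0.
have dz : dW W z != 0 by apply: (dW_neq0 hwt) => //; case: hnd.
pose x i := l * theta_J w h i + theta i.
pose d : 'rV[complex R]_m.+1 := \row_i expi (x i).
have dE : cdiag g *m reeb w h l = diag_mx d.
  rewrite /reeb /cdiag mulmx_diag; congr diag_mx; apply/rowP => i.
  by rewrite !mxE (htheta i).2 -expiD addrC [theta_J _ _ _ * l]mulrC.
(* Some fixed point [y] of [g R_l] has a nonzero [i]-th partial derivative. Differentiating the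
   equivariance of [W] there reads off the [i]-th entry of [g R_l]. *)
have dI i : i \notin I -> expi (x i) = expi l.
  rewrite inE => /asboolPn /existsNP[y /not_implyP[yfix /eqP Wy]].
  have Wd y' : weval W (cdiag d^T *m y') = expi l * weval W y'.
    rewrite /cdiag trmxK -dE -mulmxA hg.2.
    exact: weval_reeb.
  have dy : cdiag d^T *m y = y.
    apply/matrixP => k j; rewrite (ord1 j) cdiagE !mxE.
    have [->|/yfix xk] := eqVneq (y k 0) 0; first by rewrite mulr0.
    by rewrite expi_int ?mul1r // /x addrC.
  have := wpartial_diag Wd y i; rewrite dy !mxE => /(mulIf Wy); exact.
pose nu := normal W w h z 0.
have nuE i : nu i 0 = Num.conj (wpartial W i z) by rewrite /nu /normal reeb0 mul1mx !mxE.
have nu0 : nu != 0 by exact: normal0_neq0.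
(* The partial derivatives indexed by [I] vanish at the fixed point [z], so the normal vector is
   supported outside [I], where [d] is the scalar [expi l]. *)
have nuI i : nu i 0 != 0 -> i \notin I.
  apply: contraNN; rewrite inE => /asboolP /(_ z zfix) Wz.
  by rewrite nuE Wz rmorph0.
have [i0 nui0] : exists i0, nu i0 0 != 0.
  apply/existsP; apply: contraNT nu0 => /existsPn nu0; apply/eqP/matrixP => i j.
  by rewrite (ord1 j) [RHS]mxE; apply/eqP/negPn.
have i0I := nuI i0 nui0.
have [|E [nuE0 EE dEE]] := @exists_eigenframe _ _ nu d i0 nui0.
  by move=> i /nuI /dI xi; rewrite !mxE xi dI.
(* Real phases for the eigenvalues. Outside [I] the phase is taken to be [l], which has the same
   exponential by [dI]; [distribute_shift] takes care of the integers. *)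
pose b j := if lift i0 j \in I then x (lift i0 j) else l.
have db : (\row_j d 0 (lift i0 j)) = \row_j expi (b j).
  by apply/rowP => j; rewrite !mxE /b; case: ifPn => // /dI.
rewrite {}db in dEE.
have zl : 0 <= (0 : R) <= l by rewrite lexx ltW.
have ll : 0 <= l <= l by rewrite lexx ltW.
split.
  (* The eigenvectors are carried along by the flow while column [j] is turned back at constant
     speed, so that at time [l] the eigenvalue [expi (b j)] of [g R_l] is undone. *)
  exists (fun t => reeb w h t *m E *m diag_mx (\row_j expi (- (b j / l) * t))).
  have uD t : unitary (diag_mx (\row_j expi (- (b j / l) * t))) by exact: unitary_diag_expi.
  split.
  - apply: mx_continuous_mcont => t; apply: mcontM.
      by apply: mcontM; [exact: reeb_cont|exact: mcont_cst].
    apply: mcont_diag => i j; under eq_fun do rewrite mxE.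
    by apply: ccont_expi; apply: continuousM; [exact: cst_continuous|exact: cvg_id].
  - move=> t _; rewrite !mulmxA (dW_reeb hwt) -!scalemxAl.
    move: nuE0; rewrite /nu /normal adjointK reeb0 mul1mx => ->.
    by rewrite mul0mx scaler0.
  - move=> t _; rewrite !adjointM -!mulmxA [adjoint (reeb _ _ _) *m _]mulmxA.
    by rewrite reeb_unitary mul1mx [adjoint E *m _]mulmxA EE mul1mx uD.
  - rewrite !mulmxA dE dEE reeb0 mul1mx -[X in X = _]mulmxA mulmx_diag; congr (_ *m diag_mx _).
    by apply/rowP => j; rewrite !mxE mulr0 expi0 mulNr divfK ?gt_eqF // expiM_N.
move=> F [Fc Fker FF gF].
have [phi [cphi phi_arg detA]] := residue_lift hwt hl dz Fc Fker FF.
pose A t := flow_in_frame w h F t.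
pose psi t := (\sum_i theta_J w h i) * t - t - (phi t - phi 0).
have cpsi t : 0 <= t <= l -> {for t, continuous psi}.
  move=> tl; apply: continuousB; last first.
    by apply: continuousB; [exact: cphi|exact: cst_continuous].
  apply: continuousB; last exact: cvg_id.
  by apply: continuousM; [exact: cst_continuous|exact: cvg_id].
have psi0 : psi 0 = 0 by rewrite /psi mulr0 !subrr.
have nuF : adjoint nu *m F 0 = 0 by rewrite /nu /normal adjointK Fker.
(* The columns of E diagonalize the return map in any equivariant frame. *)
pose P := adjoint (F 0) *m E.
have FP : F 0 *m P = E by exact: (frame_kernelM nu0 nuF (FF 0 zl) nuE0).
have EP : E *m adjoint P = F 0.
  by rewrite /P adjointM adjointK; exact: (frame_kernelM nu0 nuE0 EE nuF).
have uP : unitary P.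
  by rewrite /unitary {2}/P mulmxA -adjointM FP.
have Al : A l = P *m diag_mx (\row_j expi (b j)) *m adjoint P.
  rewrite /A /flow_in_frame.
  have -> : adjoint (F l) = adjoint (F 0) *m cdiag g.
    have ug : unitary (cdiag g).
      rewrite /cdiag (_ : g^T = \row_j expi (theta j)); first exact: unitary_diag_expi.
      by apply/rowP => j; rewrite !mxE (htheta j).2.
    by rewrite -gF adjointM -mulmxA ug mulmx1.
  rewrite -mulmxA [cdiag g *m _]mulmxA dE -EP !mulmxA; congr (_ *m _).
  by rewrite -[LHS]mulmxA dEE !mulmxA EP.
have uA := flow_path hwt hl dz Fc Fker FF.
have psib : psi l - \sum_j b j \is a Num.int.
  rewrite -expi_eq -detA // -/(A l) Al !det_mulmx det_adjoint mulrAC [_ * Num.conj _]mulrC.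
  rewrite det_unitary // mul1r det_diag expi_sum; apply/eqP; apply: eq_bigr => j _.
  by rewrite mxE.
(* The determinant of an empty matrix is 1, so [psi] takes integer values. *)
have psim : m = 0%N -> psi l = 0.
  move=> m0; apply: (int_valued_path hl cpsi) => // t tl.
  rewrite -expi_eq1 -detA //; move: (flow_in_frame w h F t); rewrite m0 => B.
  by rewrite det_mx00.
have [a [ab sum_a sumQ]] := distribute_shift psib psim.
exists (residue W w h z F), phi, (\sum_j Q (a j)); split.
- exact: residueP.
- exact: phi_arg.
- have A0 : flow_in_frame w h F (clamp l 0) = 1%:M.
    by rewrite (clamp_id zl) /flow_in_frame reeb0 mul1mx (FF 0 zl).
  have Ala : flow_in_frame w h F (clamp l l) =
      P *m diag_mx (\row_j expi (a j)) *m adjoint P.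
    rewrite (clamp_id ll) -/(A l) Al; congr (_ *m diag_mx _ *m _).
    by apply/rowP => j; rewrite !mxE ab.
  have detA_clamp t : 0 <= t <= l -> \det (flow_in_frame w h F (clamp l t)) = expi (psi t).
    by move=> tl; rewrite (clamp_id tl) (detA t tl).
  have Psi_clamp t : 0 <= t <= l ->
      realify (flow_in_frame w h F t) = realify (flow_in_frame w h F (clamp l t)).
    by move=> tl; rewrite (clamp_id tl).
  exact: (RS_index_unitary hl uP uA A0 Ala cpsi detA_clamp psi0 (esym sum_a) Psi_clamp).
(* In [psi l - \sum_j b j] the terms [l * theta_J] over [I] cancel and leave [- theta]; the [- l] of
   the normal direction completes [(#|~: I| - 1) * l] to one [l] for each index outside [I]. *)
- rewrite sumQ.
  have -> : \sum_j b j = \sum_(i in I) x i + (#|~: I|%:R - 1) * l.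
    exact: (sum_lift_partition x l i0I).
  have -> : \sum_j Q (b j) = \sum_(i in I) Q (x i) + (#|~: I|%:R - 1) * Q l.
    rewrite -(sum_lift_partition (fun i => Q (x i)) (Q l) i0I); apply: eq_bigr => j _.
    by rewrite /b; case: ifP.
  have -> : psi l = l * \sum_(i in I) theta_J w h i + l * \sum_(i in ~: I) theta_J w h i
      - l - (phi l - phi 0).
    rewrite /psi mulrC (bigID (mem I)) /= mulrDr; congr (_ + _ * _ - _ - _).
    by apply: eq_bigl => i; rewrite !inE.
  rewrite /x !big_split /= -!mulr_sumr sumr_const -[- l *+ _]mulr_natr.
  ring.
Qed.
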